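(* Let $S$ be a closed oriented surface of genus at least two, and let $(f,\rho)$ be a developing pair of a $\mathbb{C}\mathrm{P}^1$-structure on $S$. Let $\Omega\subset\mathbb{C}\mathrm{P}^1$ be the domain of discontinuity of $\operatorname{Im}\rho$. Then, for each connected component $U$ of $f^{-1}(\Omega)$, the restriction of $f$ to $U$ is a covering map onto its image.
   Context: A $\mathbb{C}\mathrm{P}^1$-structure on $S$ is a $(\mathbb{C}\mathrm{P}^1,\mathrm{PSL}(2,\mathbb{C}))$-structure; equivalently, it is given by a developing pair $(f,\rho)$ consisting of a local homeomorphism $f\colon\tilde S\to\mathbb{C}\mathrm{P}^1$ on the universal cover $\tilde S$ of $S$ and a homomorphism $\rho\colon\pi_1(S)\to\mathrm{PSL}(2,\mathbb{C})$ with $f\alpha=\rho(\alpha)f$ for all $\alpha\in\pi_1(S)$. For a subgroup $\Gamma\subset\mathrm{PSL}(2,\mathbb{C})$, the limit set of $\Gamma$ is the set of accumulation points in $\mathbb{C}\mathrm{P}^1=\partial\mathbb{H}^3$ of a $\Gamma$-orbit of a point of $\mathbb{H}^3$ (independent of the point), and the domain of discontinuity of $\Gamma$ is the complement of the limit set in $\mathbb{C}\mathrm{P}^1$. *)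

(* Defs.v *)
From HB Require Import structures.
From Stdlib Require Import Relation_Operators.
From mathcomp Require Import all_boot all_order all_algebra.
From mathcomp Require Import all_classical all_reals all_analysis.
From mathcomp Require Import homotopy generic_quotient complex ring lra.

Set Implicit Arguments.
Unset Strict Implicit.
Unset Printing Implicit Defensive.

Import Order.TTheory GRing.Theory Num.Theory.
Import numFieldNormedType.Exports.
Local Open Scope classical_set_scope.
Local Open Scope ring_scope.
Local Open Scope complex_scope.
Local Open Scope quotient_scope.

HB.instance Definition _ (R : rcfType) := NormedModule.copy R[i] R[i]^o.

Section Maps.
Context {X Y : topologicalType}.
Implicit Types (A : set X) (B : set Y) (f : X -> Y).

(* A homeomorphism between the subspaces A and B is a continuous bijection that
   maps relatively open sets to relatively open sets. *)
Definition homeo_between A B f :=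
  [/\ set_bij A B f, {within A, continuous f} &
      forall O, open O -> exists2 O', open O' & f @` (A `&` O) = B `&` O'].

Definition local_homeo f := forall x, exists O : set X,
  [/\ open_nbhs x O, open (f @` O) & homeo_between O (f @` O) f].

(* f restricts to a covering map from the subspace A onto the subspace B: every
   y in B has a relatively open neighbourhood B `&` O whose preimage in A is the
   disjoint union of the relatively open sets in F, each of them mapped
   homeomorphically onto B `&` O. *)
Definition covering_map_between A B f :=
  [/\ f @` A = B, {within A, continuous f} &
      forall y, B y -> exists2 O, open_nbhs y O &
        exists F : set (set X),
          [/\ \bigcup_(V in F) V = A `&` f @^-1` O,
              trivIset F id &
              forall V, F V -> (exists2 O', open O' & V = A `&` O') /\
                               homeo_between V (B `&` O) f]].

End Maps.

Section Surfaces.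
Context {R : realType}.

Definition locally_euclidean2 (S : topologicalType) := forall s : S,
  exists O (h : S -> R * R), [/\ open_nbhs s O, open (h @` O) &
                                 homeo_between O (h @` O) h].

(* Second countability is automatic for compact locally Euclidean spaces. *)
Definition closed_surface (S : topologicalType) :=
  [/\ hausdorff_space S, compact [set: S], connected [set: S] &
      locally_euclidean2 S].

Definition unit_disk : set R[i] := [set z | `|z| <= 1].

(* The point with parameter t in [0, 1] on the k-th side (0 <= k < 4g) of the
   unit disk regarded as a (4g)-gon. *)
Definition polygon_side (g k : nat) (t : R) : R[i] :=
  let theta := 2 * trigo.pi * (k%:R + t) / (4 * g)%:R in cos theta +i* sin theta.

(* Side pairing of the boundary word
   a_0 b_0 a_0^-1 b_0^-1 ... a_(g-1) b_(g-1) a_(g-1)^-1 b_(g-1)^-1. *)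
Definition side_pairing (g : nat) (z w : R[i]) :=
  exists (j : nat) (t : R), [/\ (j < g)%N, 0 <= t <= 1 &
    (z = polygon_side g (4 * j) t /\
       w = polygon_side g (4 * j + 2) (1 - t)) \/
    (z = polygon_side g (4 * j + 1) t /\
       w = polygon_side g (4 * j + 3) (1 - t))].

(* S is the orientable surface of genus g: it is homeomorphic to the quotient of
   the (4g)-gon by its side pairing, i.e. there is a quotient map q from the
   disk onto S whose fibres are the classes of the generated equivalence. *)
Definition orientable_genus (g : nat) (S : topologicalType) :=
  exists q : R[i] -> S,
    [/\ q @` unit_disk = [set: S],
        forall A : set S,
          open A <-> exists2 O, open O & unit_disk `&` q @^-1` A =
                                         unit_disk `&` O &
        forall z w, unit_disk z -> unit_disk w ->
          (q z = q w <-> clos_refl_sym_trans _ (side_pairing g) z w)].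

Definition closed_orientable_surface (g : nat) (S : topologicalType) :=
  closed_surface S /\ orientable_genus g S.

End Surfaces.
Arguments closed_orientable_surface : clear implicits.

Section UnitInterval.
Variable R : realType.

Definition I01 : Type := set_type `[0 : R, 1]%classic.
HB.instance Definition _ := Topological.copy I01 (set_type `[0 : R, 1]%classic).

Definition ival (t : I01) : R := set_val t.

Fact clamp_subproof (r : R) :
  Num.min 1 (Num.max 0 r) \in `[0 : R, 1]%classic.
Proof.
by rewrite inE/= in_itv/= le_min ler01 le_max lexx ge_min lexx.
Qed.

Definition clamp (r : R) : I01 :=
  @exist R (fun x => x \in `[0 : R, 1]%classic) _ (clamp_subproof r).

Lemma ival_clampE r : ival (clamp r) = Num.min 1 (Num.max 0 r).
Proof. by []. Qed.

Lemma ival_itv t : 0 <= ival t <= 1.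
Proof. by have := set_valP t; rewrite /= in_itv. Qed.

Lemma clampK t : clamp (ival t) = t.
Proof.
apply: val_inj => /=; have /andP[t0 t1] := ival_itv t.
by rewrite (max_idPr t0) (min_idPr t1).
Qed.

Lemma ival_clamp r : 0 <= r -> r <= 1 -> ival (clamp r) = r.
Proof. by move=> r0 r1; rewrite ival_clampE (max_idPr r0) (min_idPr r1). Qed.

Lemma clamp_le0 r : r <= 0 -> clamp r = clamp 0.
Proof.
by move=> r0; apply: val_inj => /=; rewrite (max_idPl r0) maxxx.
Qed.

Lemma clamp_ge1 r : 1 <= r -> clamp r = clamp 1.
Proof.
move=> r1; apply: val_inj => /=.
by rewrite (max_idPr (le_trans ler01 r1)) (min_idPl r1) (max_idPr ler01) minxx.
Qed.

Fact clamp01_neq : clamp 0 != clamp 1.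
Proof.
apply/eqP => /(congr1 ival); rewrite !ival_clamp ?ler01//.
by move/eqP; rewrite eq_sym oner_eq0.
Qed.

HB.instance Definition _ := isBiPointed.Build I01 clamp01_neq.

Lemma ival_zero : ival zero = 0. Proof. exact: ival_clamp. Qed.
Lemma ival_one : ival one = 1. Proof. exact: ival_clamp. Qed.

Lemma ival_continuous : continuous ival.
Proof. exact: initial_continuous. Qed.

Lemma clamp_continuous : continuous clamp.
Proof.
apply/continuous_comp_initial.
rewrite (_ : _ \o _ = fun r : R => Num.min 1 (Num.max 0 r))//.
move=> r; apply: (@continuous_min R R (cst 1) (fun r => Num.max 0 r)).
  exact: cvg_cst.
apply: (@continuous_max R R (cst 0) id); first exact: cvg_cst.
exact: cvg_id.
Qed.

End UnitInterval.
Arguments clamp {R}.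

Section RealContinuity.
Context {R : realType} {X : topologicalType}.

Lemma continuousMf (h k : X -> R) : continuous h -> continuous k ->
  continuous (fun x => h x * k x).
Proof. by move=> ch ck x; exact: (@continuousM R X h k x (ch x) (ck x)). Qed.

Lemma continuousDf (h k : X -> R) : continuous h -> continuous k ->
  continuous (fun x => h x + k x).
Proof. by move=> ch ck x; exact: (@continuousD R R X h k x (ch x) (ck x)). Qed.

Lemma continuousBf (h k : X -> R) : continuous h -> continuous k ->
  continuous (fun x => h x - k x).
Proof. by move=> ch ck x; exact: (@continuousB R R X h k x (ch x) (ck x)). Qed.

Lemma continuous_cstf (a : R) : continuous (fun x : X => a).
Proof. by move=> x; exact: cvg_cst. Qed.

Lemma continuous_maxf (f g : X -> R) : continuous f -> continuous g ->
  continuous (fun t => Num.max (f t) (g t)).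
Proof. by move=> cf cg t; exact: (@continuous_max R X f g t (cf t) (cg t)). Qed.

Lemma continuous_minf (f g : X -> R) : continuous f -> continuous g ->
  continuous (fun t => Num.min (f t) (g t)).
Proof. by move=> cf cg t; exact: (@continuous_min R X f g t (cf t) (cg t)). Qed.

End RealContinuity.

Section Pasting.
Context {R : realType} {X T : topologicalType}.

Lemma continuous_paste (h : X -> R) (a : R) (f g : X -> T) :
  continuous h -> continuous f -> continuous g ->
  (forall x, h x = a -> f x = g x) ->
  continuous (fun x => if h x <= a then f x else g x).
Proof.
move=> ch cf cg fg x.
have [hxa|hxa|hxa] := ltgtP (h x) a.
- have near_lt : \forall y \near x, h y < a.
    by apply: (cvgr_lt (h x)) => //; exact: ch.
  move=> U fU.
  change (\forall y \near x, U (if h y <= a then f y else g y)).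
  move: fU; rewrite /= (ltW hxa) => fU.
  have Uf : \forall y \near x, U (f y) by exact: (cf x U fU).
  apply: filterS2 near_lt Uf => y hya Ufy.
  by rewrite (ltW hya).
- have near_gt : \forall y \near x, a < h y.
    by apply: (cvgr_gt (h x)) => //; exact: ch.
  move=> U fU.
  change (\forall y \near x, U (if h y <= a then f y else g y)).
  move: fU; rewrite /= leNgt hxa => fU.
  have Ug : \forall y \near x, U (g y) by exact: (cg x U fU).
  apply: filterS2 near_gt Ug => y hya Ugy.
  by rewrite leNgt hya.
- move=> U fU.
  move: fU; rewrite /= hxa lexx => fU.
  have Vf : \forall y \near x, U (f y) by exact: (cf x U fU).
  have Vg : \forall y \near x, U (g y) by apply: (cg x U); rewrite -fg//.
  change (\forall y \near x, U (if h y <= a then f y else g y)).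
  by apply: filterS2 Vf Vg => y; case: ifP.
Qed.

Lemma clamp_comp_continuous (h : X -> R) :
  continuous h -> continuous (fun x => clamp (h x)).
Proof.
by move=> ch x; apply: continuous_comp; [exact: ch|exact: clamp_continuous].
Qed.

Lemma clamp_path_continuous (c : I01 R -> T) (h : X -> R) :
  continuous c -> continuous h -> continuous (fun x => c (clamp (h x))).
Proof.
move=> cc ch; have chc := clamp_comp_continuous ch.
move=> x; apply: (@continuous_comp _ _ _ (fun x => clamp (h x)) c x).
  exact: chc.
exact: cc.
Qed.

Lemma clamp2_path_continuous (H : I01 R * I01 R -> T) (h k : X -> R) :
  continuous H -> continuous h -> continuous k ->
  continuous (fun x => H (clamp (h x), clamp (k x))).
Proof.
move=> cH ch ck x.
apply: (@continuous_comp _ _ _ (fun x => (clamp (h x), clamp (k x))) H x).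
  exact: (cvg_pair (clamp_comp_continuous ch (x := x))
    (clamp_comp_continuous ck (x := x))).
exact: cH.
Qed.

End Pasting.

Section Homotopy.
Context {R : realType} {T : topologicalType}.
Local Notation I := (I01 R).
Implicit Types x y z : T.

Definition path_homotopic x y (a b : {path I from x to y in T}) :=
  exists H : I * I -> T,
    [/\ continuous H,
        forall t, H (t, zero) = a t,
        forall t, H (t, one) = b t &
        forall s, H (zero, s) = x /\ H (one, s) = y].

Definition path_cat_fun (a b : I -> T) (t : I) : T :=
  if ival t <= 2^-1 then a (clamp (2 * ival t))
  else b (clamp (2 * ival t - 1)).

Section Cat.
Variables (x y z : T).
Variables (a : {path I from x to y in T}) (b : {path I from y to z in T}).

Fact path_cat_continuous : continuous (path_cat_fun a b).
Proof.
apply: (@continuous_paste R I T (@ival R) 2^-1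
  (fun t => a (clamp (2 * ival t))) (fun t => b (clamp (2 * ival t - 1)))).
- exact: ival_continuous.
- apply: clamp_path_continuous; first exact: cts_fun.
  by apply: continuousMf; [exact: continuous_cstf|exact: ival_continuous].
- apply: clamp_path_continuous; first exact: cts_fun.
  apply: continuousBf; last exact: continuous_cstf.
  by apply: continuousMf; [exact: continuous_cstf|exact: ival_continuous].
- move=> t ->; rewrite divff// subrr.
  have -> : clamp 1 = one :> I by [].
  have -> : clamp 0 = zero :> I by [].
  by rewrite path_zero path_one.
Qed.

Fact path_cat_zero : path_cat_fun a b zero = x.
Proof.
rewrite /path_cat_fun ival_zero invr_ge0 ler0n mulr0.
exact: path_zero.
Qed.

Fact path_cat_one : path_cat_fun a b one = z.
Proof.
rewrite /path_cat_fun ival_one ifF; last by apply/negbTE; lra.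
rewrite (_ : 2 * 1 - 1 = 1); last by lra.
exact: path_one.
Qed.

(* First a, then b. *)
Definition path_cat : {path I from x to z in T} :=
  mk_path path_cat_continuous path_cat_zero path_cat_one.

End Cat.

Section Rev.
Variables (x y : T) (a : {path I from x to y in T}).

Definition path_rev_fun (t : I) : T := a (clamp (1 - ival t)).

Fact path_rev_continuous : continuous path_rev_fun.
Proof.
apply: clamp_path_continuous; first exact: cts_fun.
by apply: continuousBf; [exact: continuous_cstf|exact: ival_continuous].
Qed.

Fact path_rev_zero : path_rev_fun zero = y.
Proof. rewrite /path_rev_fun ival_zero subr0; exact: path_one. Qed.

Fact path_rev_one : path_rev_fun one = x.
Proof. rewrite /path_rev_fun ival_one subrr; exact: path_zero. Qed.

Definition path_rev : {path I from y to x in T} :=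
  mk_path path_rev_continuous path_rev_zero path_rev_one.

End Rev.

Definition path_cst x : {path I from x to x in T} :=
  mk_path (f := cst x) (fun t => @cvg_cst T x I (nbhs t) _) erefl erefl.

Lemma fst_cts : continuous (fun ts : I * I => ival ts.1).
Proof.
by move=> ts; apply: continuous_comp; [exact: cvg_fst|exact: ival_continuous].
Qed.

Lemma snd_cts : continuous (fun ts : I * I => ival ts.2).
Proof.
by move=> ts; apply: continuous_comp; [exact: cvg_snd|exact: ival_continuous].
Qed.

Lemma path_homotopic_reparam x y (a b : {path I from x to y in T})
    (c : I -> T) (phi psi : I -> R) :
  continuous c -> continuous phi -> continuous psi ->
  phi zero = psi zero -> phi one = psi one ->
  (forall t, a t = c (clamp (phi t))) -> (forall t, b t = c (clamp (psi t))) ->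
  path_homotopic a b.
Proof.
move=> cc cphi cpsi e0 e1 aE bE.
exists (fun ts => c (clamp (phi ts.1 + ival ts.2 * (psi ts.1 - phi ts.1)))).
split.
- apply: clamp_path_continuous; first exact: cc.
  move=> ts.
  have cphi1 : continuous (fun ts : I * I => phi ts.1).
    by move=> us; apply: continuous_comp; [exact: cvg_fst|exact: cphi].
  have cpsi1 : continuous (fun ts : I * I => psi ts.1).
    by move=> us; apply: continuous_comp; [exact: cvg_fst|exact: cpsi].
  apply: continuousDf; first exact: cphi1.
  by apply: continuousMf; [exact: snd_cts|exact: continuousBf].
- by move=> t /=; rewrite ival_zero mul0r addr0 aE.
- by move=> t /=; rewrite ival_one mul1r addrC subrK bE.
- move=> s /=; rewrite e0 e1 !subrr !mulr0 !addr0 -e0 -e1 -!aE.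
  by rewrite path_zero path_one.
Qed.

Lemma path_homotopic_refl x y (a : {path I from x to y in T}) :
  path_homotopic a a.
Proof.
apply: (@path_homotopic_reparam _ _ a a a (@ival R) (@ival R)) => //.
- exact: cts_fun.
- exact: ival_continuous.
- exact: ival_continuous.
- by move=> t; rewrite clampK.
- by move=> t; rewrite clampK.
Qed.

Lemma path_homotopic_sym x y (a b : {path I from x to y in T}) :
  path_homotopic a b -> path_homotopic b a.
Proof.
move=> [H [cH H0 H1 He]].
exists (fun ts => H (clamp (ival ts.1), clamp (1 - ival ts.2))); split.
- apply: clamp2_path_continuous; first exact: cH.
    exact: fst_cts.
  by apply: continuousBf; [exact: continuous_cstf|exact: snd_cts].
- move=> t /=; rewrite ival_zero subr0 clampK; exact: H1.
- move=> t /=; rewrite ival_one subrr clampK; exact: H0.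
- by move=> s /=; rewrite !clampK; exact: He.
Qed.

Lemma path_homotopic_trans x y (b a c : {path I from x to y in T}) :
  path_homotopic a b -> path_homotopic b c -> path_homotopic a c.
Proof.
move=> [H [cH H0 H1 He]] [K [cK K0 K1 Ke]].
exists (fun ts => if ival ts.2 <= 2^-1
  then H (clamp (ival ts.1), clamp (2 * ival ts.2))
  else K (clamp (ival ts.1), clamp (2 * ival ts.2 - 1))).
split.
- apply: (@continuous_paste R _ _ (fun ts : I * I => ival ts.2) 2^-1
    (fun ts => H (clamp (ival ts.1), clamp (2 * ival ts.2)))
    (fun ts => K (clamp (ival ts.1), clamp (2 * ival ts.2 - 1)))).
  + exact: snd_cts.
  + apply: clamp2_path_continuous; first exact: cH.
      exact: fst_cts.
    by apply: continuousMf; [exact: continuous_cstf|exact: snd_cts].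
  + apply: clamp2_path_continuous; first exact: cK.
      exact: fst_cts.
    apply: continuousBf; last exact: continuous_cstf.
    by apply: continuousMf; [exact: continuous_cstf|exact: snd_cts].
  + move=> ts ->; rewrite divff// subrr !clampK.
    by rewrite [LHS]H1 [RHS]K0.
- move=> t /=; rewrite ival_zero invr_ge0 ler0n mulr0 clampK; exact: H0.
- move=> t /=; rewrite ival_one ifF; last by apply/negbTE; lra.
  by rewrite (_ : 2 * 1 - 1 = 1) ?clampK; [exact: K1|lra].
- move=> s /=; rewrite !clampK; case: ifP => _; [exact: He|exact: Ke].
Qed.

Lemma path_homotopic_cat x y z (a a' : {path I from x to y in T})
    (b b' : {path I from y to z in T}) :
  path_homotopic a a' -> path_homotopic b b' ->
  path_homotopic (path_cat a b) (path_cat a' b').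
Proof.
move=> [H [cH H0 H1 He]] [K [cK K0 K1 Ke]].
exists (fun ts => if ival ts.1 <= 2^-1
  then H (clamp (2 * ival ts.1), clamp (ival ts.2))
  else K (clamp (2 * ival ts.1 - 1), clamp (ival ts.2))).
split.
- apply: (@continuous_paste R _ _ (fun ts : I * I => ival ts.1) 2^-1
    (fun ts => H (clamp (2 * ival ts.1), clamp (ival ts.2)))
    (fun ts => K (clamp (2 * ival ts.1 - 1), clamp (ival ts.2)))).
  + exact: fst_cts.
  + apply: clamp2_path_continuous; first exact: cH.
      2: exact: snd_cts.
    by apply: continuousMf; [exact: continuous_cstf|exact: fst_cts].
  + apply: clamp2_path_continuous; first exact: cK.
      2: exact: snd_cts.
    apply: continuousBf; last exact: continuous_cstf.
    by apply: continuousMf; [exact: continuous_cstf|exact: fst_cts].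
  + move=> ts ->; rewrite divff// subrr !clampK.
    by rewrite [LHS](He _).2 [RHS](Ke _).1.
- move=> t /=; rewrite clampK /mk_path/= /path_cat_fun.
  by case: ifP => _; rewrite ?H0 ?K0.
- move=> t /=; rewrite clampK /mk_path/= /path_cat_fun.
  by case: ifP => _; rewrite ?H1 ?K1.
- move=> s /=; rewrite ival_zero ival_one !clampK invr_ge0 ler0n mulr0; split.
    exact: (He s).1.
  rewrite ifF; last by apply/negbTE; lra.
  by rewrite (_ : 2 * 1 - 1 = 1); [exact: (Ke s).2|lra].
Qed.

Lemma path_homotopic_rev x y (a a' : {path I from x to y in T}) :
  path_homotopic a a' -> path_homotopic (path_rev a) (path_rev a').
Proof.
move=> [H [cH H0 H1 He]].
exists (fun ts => H (clamp (1 - ival ts.1), clamp (ival ts.2))); split.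
- apply: clamp2_path_continuous; first exact: cH.
    2: exact: snd_cts.
  by apply: continuousBf; [exact: continuous_cstf|exact: fst_cts].
- by move=> t /=; rewrite clampK H0.
- by move=> t /=; rewrite clampK H1.
- move=> s /=; rewrite ival_zero ival_one subr0 subrr clampK; split.
    exact: (He s).2.
  exact: (He s).1.
Qed.

Lemma continuous_affine (a b : R) : continuous (fun t : I => a * ival t + b).
Proof.
apply: continuousDf; last exact: continuous_cstf.
by apply: continuousMf; [exact: continuous_cstf|exact: ival_continuous].
Qed.

Lemma path_homotopic_catA w x y z (a : {path I from w to x in T})
    (b : {path I from x to y in T}) (c : {path I from y to z in T}) :
  path_homotopic (path_cat a (path_cat b c)) (path_cat (path_cat a b) c).
Proof.
apply: (@path_homotopic_reparam _ _ _ _ (path_cat (path_cat a b) c)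
  (fun t => Num.max (2^-1 * ival t + 0)
     (Num.max (1 * ival t + - 4^-1) (2 * ival t + -1))) (@ival R)).
- exact: cts_fun.
- do 2?[apply: continuous_maxf; first exact: continuous_affine].
  exact: continuous_affine.
- exact: ival_continuous.
- by rewrite ival_zero; rewrite /Num.max; do 2?case: ifP; lra.
- by rewrite ival_one; rewrite /Num.max; do 2?case: ifP; lra.
- move=> t; have /andP[t0 t1] := ival_itv t; rewrite /= /mk_path /path_cat_fun.
  case: (leP (ival t) 2^-1) => h1.
    have -> : Num.max (2^-1 * ival t + 0)
      (Num.max (1 * ival t - 4^-1) (2 * ival t - 1)) = 2^-1 * ival t.
      by rewrite /Num.max; do 2?case: ifP; lra.
    rewrite ival_clamp; [|lra|lra].
    rewrite ifT; last lra.
    rewrite ival_clamp; [|lra|lra].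
    rewrite ifT; last lra.
    by congr (a (clamp _)); lra.
  rewrite ival_clamp; [|lra|lra].
  case: (leP (2 * ival t - 1) 2^-1) => h2.
    have -> : Num.max (2^-1 * ival t + 0)
      (Num.max (1 * ival t - 4^-1) (2 * ival t - 1)) = ival t - 4^-1.
      by rewrite /Num.max; do 2?case: ifP; lra.
    rewrite ival_clamp; [|lra|lra].
    rewrite ifT; last lra.
    rewrite ival_clamp; [|lra|lra].
    rewrite ifF; last by apply/negbTE; lra.
    by congr (b (clamp _)); lra.
  have -> : Num.max (2^-1 * ival t + 0)
    (Num.max (1 * ival t - 4^-1) (2 * ival t - 1)) = 2 * ival t - 1.
    by rewrite /Num.max; do 2?case: ifP; lra.
  rewrite ival_clamp; [|lra|lra].
  by rewrite ifF//; apply/negbTE; lra.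
- by move=> t; rewrite clampK.
Qed.

Lemma path_homotopic_cst_cat x y (a : {path I from x to y in T}) :
  path_homotopic (path_cat (path_cst x) a) a.
Proof.
apply: (@path_homotopic_reparam _ _ _ _ a
  (fun t => Num.max (0 * ival t + 0) (2 * ival t + -1)) (@ival R)).
- exact: cts_fun.
- by apply: continuous_maxf; exact: continuous_affine.
- exact: ival_continuous.
- by rewrite ival_zero; rewrite /Num.max; case: ifP; lra.
- by rewrite ival_one; rewrite /Num.max; case: ifP; lra.
- move=> t; have /andP[t0 t1] := ival_itv t; rewrite /= /mk_path /path_cat_fun.
  case: (leP (ival t) 2^-1) => h1.
    rewrite (_ : Num.max _ _ = 0); last by rewrite /Num.max; case: ifP; lra.
    by symmetry; exact: path_zero.
  by rewrite (_ : Num.max _ _ = 2 * ival t - 1)// /Num.max; case: ifP; lra.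
- by move=> t; rewrite clampK.
Qed.

Lemma path_homotopic_cat_cst x y (a : {path I from x to y in T}) :
  path_homotopic (path_cat a (path_cst y)) a.
Proof.
apply: (@path_homotopic_reparam _ _ _ _ a
  (fun t => Num.min (0 * ival t + 1) (2 * ival t + 0)) (@ival R)).
- exact: cts_fun.
- by apply: continuous_minf; exact: continuous_affine.
- exact: ival_continuous.
- by rewrite ival_zero; rewrite /Num.min; case: ifP; lra.
- by rewrite ival_one; rewrite /Num.min; case: ifP; lra.
- move=> t; have /andP[t0 t1] := ival_itv t; rewrite /= /mk_path /path_cat_fun.
  case: (leP (ival t) 2^-1) => h1.
    by rewrite (_ : Num.min _ _ = 2 * ival t)// /Num.min; case: ifP; lra.
  rewrite (_ : Num.min _ _ = 1); last by rewrite /Num.min; case: ifP; lra.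
  by symmetry; exact: path_one.
- by move=> t; rewrite clampK.
Qed.

Lemma path_homotopic_cat_rev x y (a : {path I from x to y in T}) :
  path_homotopic (path_cat a (path_rev a)) (path_cst x).
Proof.
apply: (@path_homotopic_reparam _ _ _ _ a
  (fun t => Num.min (2 * ival t + 0) (- 2 * ival t + 2)) (cst 0)).
- exact: cts_fun.
- by apply: continuous_minf; exact: continuous_affine.
- exact: continuous_cstf.
- by rewrite ival_zero; rewrite /Num.min /cst; case: ifP; lra.
- by rewrite ival_one; rewrite /Num.min /cst; case: ifP; lra.
- move=> t; have /andP[t0 t1] := ival_itv t.
  rewrite /= /mk_path /path_cat_fun /=.
  case: (leP (ival t) 2^-1) => h1.
    by congr (a (clamp _)); rewrite /Num.min; case: ifP; lra.
  rewrite /path_rev_fun ival_clamp; [|lra|lra].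
  by congr (a (clamp _)); rewrite /Num.min; case: ifP; lra.
- by move=> t; symmetry; exact: path_zero.
Qed.

Lemma path_homotopic_rev_cat x y (a : {path I from x to y in T}) :
  path_homotopic (path_cat (path_rev a) a) (path_cst y).
Proof.
apply: (@path_homotopic_reparam _ _ _ _ a
  (fun t => Num.max (- 2 * ival t + 1) (2 * ival t + -1)) (cst 1)).
- exact: cts_fun.
- by apply: continuous_maxf; exact: continuous_affine.
- exact: continuous_cstf.
- by rewrite ival_zero; rewrite /Num.max /cst; case: ifP; lra.
- by rewrite ival_one; rewrite /Num.max /cst; case: ifP; lra.
- move=> t; have /andP[t0 t1] := ival_itv t.
  rewrite /= /mk_path /path_cat_fun /=.
  case: (leP (ival t) 2^-1) => h1.
    rewrite /path_rev_fun ival_clamp; [|lra|lra].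
    by congr (a (clamp _)); rewrite /Num.max; case: ifP; lra.
  by congr (a (clamp _)); rewrite /Num.max; case: ifP; lra.
- by move=> t; symmetry; exact: path_one.
Qed.

End Homotopy.

Section FundamentalGroup.
Variables (R : realType) (T : topologicalType) (x : T).

Definition loop := {path I01 R from x to x in T}.

Definition loop_rel (a b : loop) : bool := `[< path_homotopic a b >].

Fact loop_rel_equiv : equiv_class_of loop_rel.
Proof.
split=> [a|a b|b a c].
- by apply/asboolP; exact: path_homotopic_refl.
- by apply/asboolP/asboolP; exact: path_homotopic_sym.
- by move=> /asboolP ab /asboolP bc; apply/asboolP/(path_homotopic_trans ab bc).
Qed.

Canonical loop_equiv := EquivRelPack loop_rel_equiv.

Definition pi1 := {eq_quot loop_equiv}.
HB.instance Definition _ := Choice.on pi1.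
HB.instance Definition _ := EqQuotient.on pi1.

Definition pi1_class (a : loop) : pi1 := \pi_pi1 a.

Lemma pi1_classP (a b : loop) :
  pi1_class a = pi1_class b <-> path_homotopic a b.
Proof. by split=> [/eqmodP/asboolP|ab]; last exact/eqmodP/asboolP. Qed.

Lemma repr_pi1_class (a : loop) : path_homotopic (repr (pi1_class a)) a.
Proof. by apply/pi1_classP; rewrite /pi1_class reprK. Qed.

Definition pi1_one : pi1 := pi1_class (path_cst x).
Definition pi1_inv (u : pi1) : pi1 := pi1_class (path_rev (repr u)).
Definition pi1_mul (u v : pi1) : pi1 :=
  pi1_class (path_cat (repr u) (repr v)).

Lemma pi1_mul_class (a b : loop) :
  pi1_mul (pi1_class a) (pi1_class b) = pi1_class (path_cat a b).
Proof.
by apply/pi1_classP; apply: path_homotopic_cat; exact: repr_pi1_class.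
Qed.

Lemma pi1_inv_class (a : loop) :
  pi1_inv (pi1_class a) = pi1_class (path_rev a).
Proof. by apply/pi1_classP/path_homotopic_rev/repr_pi1_class. Qed.

Lemma pi1_ind (P : pi1 -> Prop) : (forall a, P (pi1_class a)) -> forall u, P u.
Proof. by move=> Pa u; rewrite -[u]reprK; exact: Pa. Qed.

Fact pi1_mulA : associative pi1_mul.
Proof.
elim/pi1_ind=> a; elim/pi1_ind=> b; elim/pi1_ind=> c.
by rewrite !pi1_mul_class; apply/pi1_classP/path_homotopic_catA.
Qed.

Fact pi1_mul1g : left_id pi1_one pi1_mul.
Proof.
elim/pi1_ind=> a; rewrite !pi1_mul_class.
exact/pi1_classP/path_homotopic_cst_cat.
Qed.

Fact pi1_mulg1 : right_id pi1_one pi1_mul.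
Proof.
elim/pi1_ind=> a; rewrite !pi1_mul_class.
exact/pi1_classP/path_homotopic_cat_cst.
Qed.

Fact pi1_mulVg : left_inverse pi1_one pi1_inv pi1_mul.
Proof.
elim/pi1_ind=> a; rewrite pi1_inv_class pi1_mul_class.
exact/pi1_classP/path_homotopic_rev_cat.
Qed.

Fact pi1_mulgV : right_inverse pi1_one pi1_inv pi1_mul.
Proof.
elim/pi1_ind=> a; rewrite pi1_inv_class pi1_mul_class.
exact/pi1_classP/path_homotopic_cat_rev.
Qed.

HB.instance Definition _ := isGroup.Build pi1
  pi1_mulA pi1_mul1g pi1_mulg1 pi1_mulVg pi1_mulgV.

End FundamentalGroup.
Arguments pi1_class {R T x}.

Definition simply_connected (R : realType) (T : topologicalType) :=
  (forall x y : T, inhabited {path I01 R from x to y in T}) /\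
  (forall (x : T) (a : loop R x), path_homotopic a (path_cst x)).

Section UniversalCovering.
Context {R : realType} {S St : topologicalType}.
Implicit Types (p : St -> S) (tau : St -> St).

Definition universal_covering p :=
  simply_connected R St /\ covering_map_between [set: St] [set: S] p.

Definition deck_transformation p tau :=
  homeo_between [set: St] [set: St] tau /\ p \o tau =1 p.

(* The action of pi1(S, p x0) on the universal cover determined by the base
   point x0: the class of a acts by the (unique) deck transformation that sends
   x0 to the end point of the lift of a starting at x0. *)
Definition deck_action p (x0 : St) (act : pi1 R (p x0) -> St -> St) :=
  (forall alpha, deck_transformation p (act alpha)) /\
  (forall (a : loop R (p x0)) y (c : {path I01 R from x0 to y in St}),
     p \o c =1 a -> act (pi1_class a) x0 = y).

End UniversalCovering.
Arguments universal_covering R {S St} p.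

Section PSL2.
Variable R : realType.

Definition SL2 := {A : 'M[R[i]]_2 | \det A == 1}.
HB.instance Definition _ := Choice.on SL2.

Fact SL2_one_subproof : \det (1%:M : 'M[R[i]]_2) == 1.
Proof. by rewrite det1. Qed.
Definition SL2_one : SL2 :=
  @exist _ (fun M : 'M[R[i]]_2 => \det M == 1) _ SL2_one_subproof.

Fact SL2_mul_subproof (A B : SL2) : \det (val A *m val B) == 1.
Proof. by rewrite det_mulmx (eqP (valP A)) (eqP (valP B)) mulr1. Qed.
Definition SL2_mul (A B : SL2) : SL2 :=
  @exist _ (fun M : 'M[R[i]]_2 => \det M == 1) _ (SL2_mul_subproof A B).

Fact SL2_inv_subproof (A : SL2) : \det (invmx (val A)) == 1.
Proof. by rewrite det_inv (eqP (valP A)) invr1. Qed.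
Definition SL2_inv (A : SL2) : SL2 :=
  @exist _ (fun M : 'M[R[i]]_2 => \det M == 1) _ (SL2_inv_subproof A).

Fact SL2_unit (A : SL2) : val A \in unitmx.
Proof. by rewrite unitmxE (eqP (valP A)) unitr1. Qed.

Fact SL2_mulA : associative SL2_mul.
Proof. by move=> A B C; apply: val_inj; exact: mulmxA. Qed.
Fact SL2_mul1g : left_id SL2_one SL2_mul.
Proof. by move=> A; apply: val_inj; exact: mul1mx. Qed.
Fact SL2_mulg1 : right_id SL2_one SL2_mul.
Proof. by move=> A; apply: val_inj; exact: mulmx1. Qed.
Fact SL2_mulVg : left_inverse SL2_one SL2_inv SL2_mul.
Proof. by move=> A; apply: val_inj; exact: (mulVmx (SL2_unit A)). Qed.
Fact SL2_mulgV : right_inverse SL2_one SL2_inv SL2_mul.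
Proof. by move=> A; apply: val_inj; exact: (mulmxV (SL2_unit A)). Qed.

HB.instance Definition _ := isGroup.Build SL2
  SL2_mulA SL2_mul1g SL2_mulg1 SL2_mulVg SL2_mulgV.

Definition pm_rel (A B : SL2) := (val A == val B) || (val A == - val B).

Fact pm_rel_equiv : equiv_class_of pm_rel.
Proof.
split=> [A|A B|B A C]; rewrite /pm_rel ?eqxx//.
- by rewrite eq_sym; congr (_ || _); rewrite -eqr_oppLR eq_sym.
- move=> /orP[]/eqP-> /orP[]/eqP->; rewrite ?opprK ?eqxx ?orbT//.
Qed.

Canonical pm_equiv := EquivRelPack pm_rel_equiv.

Definition PSL2 := {eq_quot pm_equiv}.
HB.instance Definition _ := Choice.on PSL2.
HB.instance Definition _ := EqQuotient.on PSL2.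

Definition psl2_class (A : SL2) : PSL2 := \pi_PSL2 A.

Lemma psl2_classP (A B : SL2) :
  psl2_class A = psl2_class B <-> val A = val B \/ val A = - val B.
Proof.
split=> [/eqmodP/orP[]/eqP|[]/eqP AB]; [by left|by right| |];
  by apply/eqmodP; rewrite /= /pm_rel AB ?orbT.
Qed.

Lemma repr_psl2_class (A : SL2) :
  val (repr (psl2_class A)) = val A \/ val (repr (psl2_class A)) = - val A.
Proof. by apply/psl2_classP; rewrite /psl2_class reprK. Qed.

Definition psl2_one : PSL2 := psl2_class SL2_one.
Definition psl2_inv (u : PSL2) : PSL2 := psl2_class (SL2_inv (repr u)).
Definition psl2_mul (u v : PSL2) : PSL2 :=
  psl2_class (SL2_mul (repr u) (repr v)).

Lemma psl2_mul_class (A B : SL2) :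
  psl2_mul (psl2_class A) (psl2_class B) = psl2_class (SL2_mul A B).
Proof.
apply/psl2_classP => /=.
case: (repr_psl2_class A) => ->; case: (repr_psl2_class B) => ->;
  rewrite ?mulmxN ?mulNmx ?opprK; by [left|right].
Qed.

Lemma psl2_inv_class (A : SL2) :
  psl2_inv (psl2_class A) = psl2_class (SL2_inv A).
Proof.
apply/psl2_classP => /=; case: (repr_psl2_class A) => ->; first by left.
right; have UA := SL2_unit A.
have UNA : - val A \in unitmx.
  by rewrite -scaleN1r unitmxZ// unitrN unitr1.
apply: (can_inj (mulKmx UNA)).
by rewrite mulmxV// mulNmx mulmxN opprK mulmxV.
Qed.

Lemma psl2_ind (P : PSL2 -> Prop) :
  (forall A, P (psl2_class A)) -> forall u, P u.
Proof. by move=> PA u; rewrite -[u]reprK; exact: PA. Qed.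

Fact psl2_mulA : associative psl2_mul.
Proof.
elim/psl2_ind=> A; elim/psl2_ind=> B; elim/psl2_ind=> C.
by rewrite !psl2_mul_class SL2_mulA.
Qed.
Fact psl2_mul1g : left_id psl2_one psl2_mul.
Proof. by elim/psl2_ind=> A; rewrite psl2_mul_class SL2_mul1g. Qed.
Fact psl2_mulg1 : right_id psl2_one psl2_mul.
Proof. by elim/psl2_ind=> A; rewrite psl2_mul_class SL2_mulg1. Qed.
Fact psl2_mulVg : left_inverse psl2_one psl2_inv psl2_mul.
Proof.
by elim/psl2_ind=> A; rewrite psl2_inv_class psl2_mul_class SL2_mulVg.
Qed.
Fact psl2_mulgV : right_inverse psl2_one psl2_inv psl2_mul.
Proof.
by elim/psl2_ind=> A; rewrite psl2_inv_class psl2_mul_class SL2_mulgV.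
Qed.

HB.instance Definition _ := isGroup.Build PSL2
  psl2_mulA psl2_mul1g psl2_mulg1 psl2_mulVg psl2_mulgV.

(* The Riemann sphere; None is the point at infinity. *)
Definition CP1 := one_point_compactification R[i].
HB.instance Definition _ := Topological.on CP1.

Definition mobius (A : 'M[R[i]]_2) (z : CP1) : CP1 :=
  if z is Some w then
    if A 1 0 * w + A 1 1 == 0 then None
    else Some ((A 0 0 * w + A 0 1) / (A 1 0 * w + A 1 1))
  else if A 1 0 == 0 then None else Some (A 0 0 / A 1 0).

Definition psl2_act (u : PSL2) : CP1 -> CP1 := mobius (val (repr u)).

Lemma mobiusN A z : mobius (- A) z = mobius A z.
Proof.
case: z => [w|] /=; rewrite !mxE !(mulNr, =^~ opprD, oppr_eq0).
  by rewrite invrN mulrN opprK.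
by rewrite invrN mulrN opprK.
Qed.

Lemma psl2_act_class (A : SL2) z : psl2_act (psl2_class A) z = mobius (val A) z.
Proof.
by rewrite /psl2_act; case: (repr_psl2_class A) => ->; rewrite ?mobiusN.
Qed.

(* Upper half-space model: (z, t) with t > 0 stands for z + t j. *)
Definition H3 : set (R[i] * R) := [set x | 0 < x.2].

Definition sqmod (z : R[i]) : R := complex.Re z ^+ 2 + complex.Im z ^+ 2.

(* Poincare extension for det A = 1: (A00 q + A01) (A10 q + A11)^-1 computed in
   the quaternions, with q = z + t j. *)
Definition poincare_ext (A : 'M[R[i]]_2) (x : R[i] * R) : R[i] * R :=
  let: (z, t) := x in
  let num := A 0 0 * z + A 0 1 in
  let den := A 1 0 * z + A 1 1 in
  let n := sqmod den + sqmod (A 1 0) * t ^+ 2 in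
  ((num * conjc den + A 0 0 * conjc (A 1 0) * (t ^+ 2)%:C) / n%:C, t / n).

Definition psl2_act3 (u : PSL2) : R[i] * R -> R[i] * R :=
  poincare_ext (val (repr u)).

Lemma poincare_extN A x : poincare_ext (- A) x = poincare_ext A x.
Proof.
case: x => z t; rewrite /poincare_ext !mxE !(mulNr, =^~ opprD).
have sN w : sqmod (- w) = sqmod w by case: w => a b; rewrite /sqmod/= !sqrrN.
have cN w : conjc (- w) = - conjc w by case: w => a b.
by rewrite !sN !cN !(mulNr, mulrN, opprK) -mulNr -opprD opprK.
Qed.

Lemma psl2_act3_class (A : SL2) x :
  psl2_act3 (psl2_class A) x = poincare_ext (val A) x.
Proof.
by rewrite /psl2_act3; case: (repr_psl2_class A) => ->; rewrite ?poincare_extN.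
Qed.

(* The closed ball formed by H3 and its boundary CP1 is the closed upper
   half-space together with the point at infinity, inside the one-point
   compactification of C x R. *)
Definition ball3 := one_point_compactification (R[i] * R)%type.
HB.instance Definition _ := Topological.on ball3.

Definition H3_to_ball (x : R[i] * R) : ball3 := Some x.
Definition CP1_to_ball (z : CP1) : ball3 := omap (fun w : R[i] => (w, 0 : R)) z.

Definition orbit3 (G : set PSL2) (x : R[i] * R) : set (R[i] * R) :=
  [set psl2_act3 u x | u in G].

(* For a subgroup G this does not depend on the choice of the point x. *)
Definition limit_set (G : set PSL2) : set CP1 :=
  [set z | exists2 x, H3 x &
     limit_point (H3_to_ball @` orbit3 G x) (CP1_to_ball z)].

Definition domain_of_discontinuity (G : set PSL2) : set CP1 := ~` limit_set G.

End PSL2.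

Definition developing_pair (R : realType) (S St : topologicalType)
    (p : St -> S) (x0 : St) (act : pi1 R (p x0) -> St -> St)
    (f : St -> CP1 R) (rho : {multiplicative pi1 R (p x0) -> PSL2 R}) :=
  local_homeo f /\
  forall alpha x, f (act alpha x) = psl2_act (rho alpha) (f x).

(* Main.v *)
Require Import Defs.
From mathcomp Require Import all_boot all_order all_algebra.
From mathcomp Require Import all_classical all_reals all_analysis.
From mathcomp Require Import homotopy complex ring lra.

Set Implicit Arguments.
Unset Strict Implicit.
Unset Printing Implicit Defensive.

Import Order.TTheory GRing.Theory Num.Theory.
Import numFieldNormedType.Exports.

Local Open Scope classical_set_scope.
Local Open Scope ring_scope.

(** The group Gamma = Im rho is equicontinuous on its domain of discontinuity
    Omega, and equicontinuity together with compactness of S yields evenly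
    covered neighbourhoods.

    Equicontinuity. Let h be a homogeneous coordinate vector of y in CP1. A
    matrix A of determinant 1 preserves the area form on C^2, so it divides the
    chordal metric near y by about |A h|^2 / |h|^2. The number |A h|^2 is also
    the value at h of the positive Hermitian form attached to the point
    A^-1 (j) of hyperbolic space ([hform_mxapp]), where j = (0, 1). Such a form
    is small near h / |h| only if its point is close to y in the closed ball.
    Hence y lies in Omega exactly when |A h|^2 >= k |h|^2 for some k > 0, for
    all A in Gamma and all h over a neighbourhood of y
    ([near_uniformly_expanded], [uniformly_expanded_domain]). So Omega is open,
    and every y in Omega has, for each d > 0, a connected open neighbourhood N
    in Omega all of whose translates under Gamma have chordal size less than d
    ([domain_equicontinuous]).

    Evenly covered neighbourhoods. As S is compact and the deck group is
    transitive on fibres, there is d > 0 such that every point x of the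
    universal cover has a deck translate at which f has an inverse branch
    defined on the whole chordal disk of size d ([uniform_chart]). If f x lies
    in the set N above, the disk around f (alpha x) = rho(alpha) (f x) contains
    rho(alpha) N, and carrying the inverse branch back by alpha gives a sheet
    of f over N through x. Two sheets over the connected set N that meet are
    equal, because the universal cover is Hausdorff; and sheets are connected,
    so those that meet a component U of the preimage of Omega lie in U
    ([covering_of_sheets]). *)

(** * Coverings from sheets *)

Section Sheets.
Context {X Y : topologicalType}.
Implicit Types (f : X -> Y) (N : set Y) (V O : set X).

Lemma connected_open_cover (T : topologicalType) (N P Q : set T) :
  connected N -> open P -> open Q -> N `<=` P `|` Q ->
  N `&` P `&` Q = set0 -> N `&` P !=set0 -> N `<=` P.
Proof.
move=> cN oP oQ NPQ dPQ NP0.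
suff NP : N `&` P = N by rewrite -NP; exact: subIsetr.
apply: cN => //; first by exists P.
exists (~` Q); first exact: open_closedC.
apply/seteqP; split=> x [Nx h]; split=> //.
  by move=> Qx; have : (N `&` P `&` Q) x by []; rewrite dPQ.
by case: (NPQ x Nx).
Qed.

Lemma local_homeo_continuous f : local_homeo f -> continuous f.
Proof.
move=> lf x; have [W [[oW Wx] _ [_ cf _]]] := lf x.
by move: cf; rewrite continuous_open_subspace// => /(_ x); apply; rewrite inE.
Qed.

Lemma local_homeo_open f O : local_homeo f -> open O -> open (f @` O).
Proof.
move=> lf oO; rewrite openE => _ [x Ox <-].
have [W [[oW Wx] ofW [_ _ /(_ _ oO)[W' oW' E]]]] := lf x.
apply: (@filterS _ _ _ (f @` (W `&` O))); first by apply: image_subset => ? [].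
rewrite E; apply: open_nbhs_nbhs; split; first exact: openI.
by rewrite -E; exists x.
Qed.

Definition sheet f N V := open V /\ set_bij V N f.

(** The inverse of f on a sheet is continuous because f is open, so the sheet
    inherits the connectedness of N. *)
Lemma sheet_connected f N V :
  (forall O, open O -> open (f @` O)) -> connected N -> sheet f N V ->
  connected V.
Proof.
move=> opf cN [oV [fVN injf surf]] B [b Bb] [C oC BC] [D cD BD].
have VC x : V x -> C x -> D x.
  by move=> Vx Cx; have : B x; [rewrite BC; split|rewrite BD => -[]].
have VD x : V x -> D x -> C x.
  by move=> Vx Dx; have : B x; [rewrite BD; split|rewrite BC => -[]].
have NP : N `<=` f @` (V `&` C).
  apply: (@connected_open_cover _ _ _ (f @` (V `&` ~` D))) => //.
  - by apply/opf/openI.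
  - by apply/opf/openI => //; exact: closed_openC.
  - move=> y /surf[x Vx <-]; have [Cx|nCx] := pselect (C x).
      by left; exists x.
    by right; exists x => //; split=> // Dx; apply: nCx; exact: VD.
  - rewrite -subset0 => y [[_ [x [Vx Cx] <-]] [x' [Vx' nDx'] xx']].
    by apply: nDx'; rewrite (injf x' x) ?inE//; exact: VC.
  - exists (f b); move: Bb; rewrite BC => -[Vb Cb].
    by split; [exact: fVN|exists b].
apply/seteqP; split=> [x|x Vx]; first by rewrite BC => -[].
rewrite BC; split=> //; have /NP[x' [Vx' Cx'] xx'] := fVN _ Vx.
by rewrite (injf x x') ?inE.
Qed.

(** Two sections of f over N agree on an open set since f is open, and disagree
    on an open set since X is Hausdorff. *)
Lemma sheet_uniq f N V V' : hausdorff_space X ->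
  (forall O, open O -> open (f @` O)) -> connected N ->
  sheet f N V -> sheet f N V' -> V `&` V' !=set0 -> V `<=` V'.
Proof.
move=> hX opf cN [oV [fVN injV surV]] [oV' [fVN' injV' surV']].
move=> [x0 [Vx0 V'x0]].
pose D := [set WW : set X * set X |
  [/\ open WW.1, open WW.2 & WW.1 `&` WW.2 = set0]].
pose Q := \bigcup_(WW in D) (f @` (V `&` WW.1) `&` f @` (V' `&` WW.2)).
have NP : N `<=` f @` (V `&` V').
  apply: (@connected_open_cover _ _ _ Q) => //.
  - by apply/opf/openI.
  - apply: bigcup_open => -[W1 W2] [/= oW1 oW2 _].
    by apply: openI; apply/opf/openI.
  - move=> y Ny; have [x Vx xy] := surV y Ny; have [x' Vx' x'y] := surV' y Ny.
    have [xx'|/eqP nxx'] := pselect (x = x').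
      by left; exists x => //; split=> //; rewrite xx'.
    right; move: hX; rewrite open_hausdorff => /(_ x x' nxx').
    case=> -[W1 W2] /= [/set_mem W1x /set_mem W2x'] [oW1 oW2 /eqP W12].
    by exists (W1, W2) => //=; split; [exists x|exists x'].
  - rewrite -subset0 => y [[_ [x [Vx V'x] <-]]].
    move=> [[W1 W2] [/= _ _ W12]] [[x1 [Vx1 W1x1] x1x] [x2 [Vx2 W2x2] x2x]].
    have e1 : x1 = x by apply: injV; rewrite ?inE.
    have e2 : x2 = x by apply: injV'; rewrite ?inE.
    have : (W1 `&` W2) x by split; [rewrite -e1|rewrite -e2].
    by rewrite W12.
  - by exists (f x0); split; [exact: fVN|exists x0].
move=> x Vx; have /NP[x' [Vx' V'x'] xx'] := fVN _ Vx.
by rewrite -(injV x' x) ?inE.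
Qed.

(** The base neighbourhoods N are required to lie in Om so that a sheet over N,
    being connected, cannot leave the component U once it meets it. *)
Lemma covering_of_sheets f (Om : set Y) :
  hausdorff_space X -> local_homeo f ->
  (forall y, Om y -> exists N, [/\ open N, connected N, N y, N `<=` Om &
     forall x, N (f x) -> exists2 V, sheet f N V & V x]) ->
  forall x0, (f @^-1` Om) x0 ->
  let U := connected_component (f @^-1` Om) x0 in
  covering_map_between U (f @` U) f.
Proof.
move=> hX lf H x0 Omx0 U.
have cf := local_homeo_continuous lf.
have opf O := @local_homeo_open f O lf.
have UOm : U `<=` f @^-1` Om by exact: connected_component_sub.
have subU N V x : connected N -> N `<=` Om -> sheet f N V -> V x -> U x ->
    V `<=` U.
  move=> cN NOm sV Vx Ux; rewrite /U (same_connected_component Ux).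
  apply: connected_component_max => //; last exact: sheet_connected sV.
  by move=> z Vz; apply: NOm; case: sV => _ [+ _ _]; exact.
split=> //; first exact: continuous_subspaceT.
move=> y [x Ux fxy]; have := H y; rewrite -fxy => /(_ (UOm _ Ux)).
move=> [N [oN cN Ny NOm sh]]; exists N => //.
exists [set V | sheet f N V /\ V `<=` U]; split.
- apply/seteqP; split=> [z [V [sV VU] Vz]|z [Uz Nz]].
    by split; [exact: VU|case: sV => _ [+ _ _]; exact].
  have [V sV Vz] := sh z Nz; exists V => //; split=> //.
  exact: subU sV Vz Uz.
- move=> V V' [sV _] [sV' _] VV'; apply/seteqP; split.
    exact: sheet_uniq sV sV' _.
  by apply: sheet_uniq sV' sV _; rewrite // setIC.
- move=> V [sV VU]; have [oV [fVN injV surV]] := sV; split.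
    by exists V => //; rewrite setIC; apply/esym/setIidPl.
  have UN : f @` U `&` N = N.
    by apply/setIidPr => z /surV[v Vv <-]; exists v => //; exact: VU.
  rewrite UN; split=> //; first exact: continuous_subspaceT.
  move=> O oO; exists (f @` (V `&` O)); first by apply/opf/openI.
  by apply/esym/setIidPr => _ [v [Vv _] <-]; exact: fVN.
Qed.

End Sheets.

(** * The universal covering *)

Section CoveringSpace.
Context {S St : topologicalType} (p : St -> S).
Hypothesis cov : covering_map_between [set: St] [set: S] p.

Lemma evenly_covered (s : S) : exists N (F : set (set St)),
  [/\ open_nbhs s N, \bigcup_(V in F) V = p @^-1` N, trivIset F id &
      forall V, F V -> sheet p N V].
Proof.
have [_ _ /(_ s I)[N nN [F [FN tF hF]]]] := cov.
exists N, F; split=> //; first by rewrite FN setTI.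
move=> V FV; have [[V' oV' VV'] [bV _ _]] := hF V FV; split.
  by rewrite VV' setTI.
by move: bV; rewrite setTI.
Qed.

Lemma covering_local_homeo : local_homeo p.
Proof.
move=> x; have [_ _ /(_ (p x) I)[N [oN Np] [F [FN tF hF]]]] := cov.
have [V FV Vx] : (\bigcup_(V in F) V) x by rewrite FN.
have [[V' oV' VV'] hV] := hF V FV; rewrite !setTI in VV' hV.
have pV : p @` V = N.
  have [[fVN _ surV] _ _] := hV.
  by apply/seteqP; split=> [_ [v Vv <-]|]; [exact: fVN|exact: surV].
by exists V; rewrite pV; split=> //; split=> //; rewrite VV'.
Qed.

(** Points in different fibres are separated downstairs, points in the same
    fibre by the sheets that contain them. *)
Lemma covering_hausdorff : hausdorff_space S -> hausdorff_space St.
Proof.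
have cp := local_homeo_continuous covering_local_homeo.
rewrite !open_hausdorff => hS x y xy.
have [pxy|/eqP pxy] := pselect (p x = p y); last first.
  have [[A B] /= [/set_mem Ax /set_mem By] [oA oB /eqP AB]] := hS _ _ pxy.
  exists (p @^-1` A, p @^-1` B) => /=; first by rewrite !inE.
  split; [exact: open_comp|exact: open_comp|].
  by rewrite -preimage_setI AB preimage_set0.
have [N [F [[oN Nx] FN tF sh]]] := evenly_covered (p x).
have [V FV Vx] : (\bigcup_(V in F) V) x by rewrite FN.
have [W FW Wy] : (\bigcup_(V in F) V) y by rewrite FN /= -pxy.
exists (V, W) => /=; first by rewrite !inE.
split; [by case: (sh _ FV)|by case: (sh _ FW)|].
apply/negPn/negP => /set0P /(tF _ _ FV FW) VW; case/negP: xy; apply/eqP.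
case: (sh _ FV) => _ [_ injV _].
by apply: injV => //; rewrite inE // VW.
Qed.

Lemma connected_in_sheet N (F : set (set St)) (V C : set St) c :
  \bigcup_(V in F) V = p @^-1` N -> trivIset F id ->
  (forall V, F V -> sheet p N V) -> connected C -> C `<=` p @^-1` N ->
  F V -> C c -> V c -> C `<=` V.
Proof.
move=> FN tF sh cC CN FV Cc Vc.
apply: (@connected_open_cover _ _ _ (\bigcup_(W in F `\ V) W)) => //.
- by case: (sh V FV).
- by apply: bigcup_open => W [/sh[]].
- move=> z /CN; rewrite -FN => -[W FW Wz].
  have [WV|WV] := pselect (W = V); first by left; rewrite -WV.
  by right; exists W.
- rewrite -subset0 => z [[_ Vz] [W [FW WV] Wz]]; apply: WV.
  by apply: tF => //; exists z.
- by exists c.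
Qed.

(** Transitivity on the fibre propagates along the path c: if c v and c w stay
    in one sheet V, a transformation that moves c v to the sheet W of x'
    carries the whole connected piece of path between them into W, hence moves
    c w to the only point of W in its fibre. This takes the place of path
    lifting. *)
Lemma fibre_transitive (R : realType) (D : set (St -> St)) (c : R -> St) :
  (forall tau, D tau -> continuous tau /\ p \o tau =1 p) ->
  continuous c ->
  let A := [set x | forall x', p x' = p x -> exists2 tau, D tau & tau x = x'] in
  A (c 0) -> forall t, A (c t).
Proof.
move=> hD cc A A0 t.
have loc (u : R) : exists2 e : R, 0 < e &
    forall v w, ball u e v -> ball u e w -> A (c v) -> A (c w).
  have [N [F [[oN Nx] FN tF sh]]] := evenly_covered (p (c u)).
  have [V FV Vcu] : (\bigcup_(V in F) V) (c u) by rewrite FN.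
  have [oV [pVN injV surV]] := sh V FV.
  have /cc/nbhs_ballP[e e0 ceV] : nbhs (c u) V by exact: open_nbhs_nbhs.
  exists e => // v w uv uw Acv x' x'w.
  have Vv : V (c v) by exact: ceV.
  have Vw : V (c w) by exact: ceV.
  have [W FW Wx'] : (\bigcup_(V in F) V) x'.
    by rewrite FN /= x'w; exact: pVN.
  have [_ [pWN injW surW]] := sh W FW.
  have [x1 Wx1 x1v] := surW (p (c v)) (pVN _ Vv).
  have [tau Dtau tauv] := Acv x1 x1v; have [ctau ptau] := hD _ Dtau.
  exists tau => //.
  have ctc : continuous (tau \o c).
    by move=> z; apply: continuous_comp; [exact: cc|exact: ctau].
  have CW : (tau \o c) @` ball u e `<=` W.
    apply: (@connected_in_sheet N F W _ (tau (c v))) => //.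
    - apply: connected_continuous_connected; last exact: continuous_subspaceT.
      apply/connected_intervalP; rewrite ball_itv.
      exact: interval_is_interval.
    - by move=> _ [z uz <-] /=; rewrite [p _](ptau (c z)); exact/pVN/ceV.
    - by exists v.
    - by rewrite tauv.
  apply: injW; rewrite ?inE//; first by apply: CW; exists w.
  by rewrite x'w; exact: ptau.
have oP (B : set St) : (forall (u : R) e v w, ball u e v -> ball u e w ->
    (forall v w, ball u e v -> ball u e w -> A (c v) -> A (c w)) ->
    B (c v) -> B (c w)) -> open (c @^-1` B).
  move=> hB; rewrite openE => u Bu; have [e e0 he] := loc u.
  apply/nbhs_ballP; exists e => // w uw.
  by apply: (hB u e u w) => //; exact: ballxx.
have := @connected_open_cover _ [set: R] (c @^-1` A) (c @^-1` (~` A)).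
apply=> //.
- by apply/connected_intervalP => ? ? ? ? ?.
- by apply: oP => u e v w uv uw h; exact: h.
- by apply: oP => u e v w uv uw h nA Aw; apply: nA; apply: h Aw.
- by move=> u _; exact: EM.
- by rewrite -subset0 => u [[_ +]].
- by exists 0.
Qed.

End CoveringSpace.

(** * The topology of the complex line *)

Local Open Scope complex_scope.

Section SquaredModulus.
Variable R : realType.
Implicit Types (z w : R[i]) (r : R).

Lemma sqmod_ge0 z : 0 <= sqmod z.
Proof. by rewrite addr_ge0 ?sqr_ge0. Qed.

Lemma sqmod0 : sqmod (0 : R[i]) = 0.
Proof. by rewrite /sqmod /= expr0n addr0. Qed.

Lemma sqmod1 : sqmod (1 : R[i]) = 1.
Proof. by rewrite /sqmod /= expr1n expr0n addr0. Qed.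

Lemma sqmod_eq0 z : (sqmod z == 0) = (z == 0).
Proof.
case: z => a b; rewrite /sqmod /= paddr_eq0 ?sqr_ge0// !sqrf_eq0.
by rewrite eq_complex.
Qed.

Lemma sqmodM z w : sqmod (z * w) = sqmod z * sqmod w.
Proof. by case: z => a b; case: w => c d; rewrite /sqmod /=; ring. Qed.

Lemma sqmodN z : sqmod (- z) = sqmod z.
Proof. by case: z => a b; rewrite /sqmod /=; ring. Qed.

Lemma sqmodBC z w : sqmod (z - w) = sqmod (w - z).
Proof. by rewrite -sqmodN opprB. Qed.

Lemma sqmodV z : sqmod z^-1 = (sqmod z)^-1.
Proof.
have [->|z0] := eqVneq z 0; first by rewrite invr0 sqmod0 invr0.
have sz0 : sqmod z != 0 by rewrite sqmod_eq0.
by apply: (mulfI sz0); rewrite -sqmodM !divff// sqmod1.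
Qed.

Lemma sqmodD z w : sqmod (z + w) <= 2 * sqmod z + 2 * sqmod w.
Proof.
case: z => a b; case: w => c d; rewrite /sqmod /=.
have := sqr_ge0 (a - c); have := sqr_ge0 (b - d); nra.
Qed.

Lemma sqmodC r : sqmod (r%:C) = r ^+ 2.
Proof. by rewrite /sqmod /= expr0n addr0. Qed.

Lemma nbhs_complexP z (U : set R[i]) :
  nbhs z U <-> exists2 r : R, 0 < r & forall w, sqmod (w - z) < r -> U w.
Proof.
have ballE (e : R) w : 0 < e -> ball z e%:C w <-> sqmod (w - z) < e ^+ 2.
  move=> e0; rewrite -ball_normE /ball_ /= normc_def ltcR sqmodBC /sqmod.
  split=> [h|h].
    rewrite -[ltLHS]sqr_sqrtr ?addr_ge0 ?sqr_ge0//.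
    by rewrite ltr_pXn2r// nnegrE ?sqrtr_ge0// ltW.
  rewrite -(@ltr_pXn2r _ 2)// ?nnegrE ?sqrtr_ge0 ?(ltW e0)//.
  by rewrite sqr_sqrtr ?addr_ge0 ?sqr_ge0.
split=> [/nbhs_ballP[e /= e0 zU]|[r r0 zU]].
  case: e e0 zU => e e'; rewrite ltcE /= => /andP[/eqP -> e0] zU.
  by exists (e ^+ 2); [rewrite exprn_gt0|move=> w /ballE wz; exact/zU/wz].
apply/nbhs_ballP; exists (Num.sqrt r)%:C; first by rewrite /= ltcR sqrtr_gt0.
by move=> w /ballE wz; apply: zU; rewrite -[r]sqr_sqrtr ?ltW//;
  apply: wz; rewrite sqrtr_gt0.
Qed.

Lemma continuous_Re : continuous (@complex.Re R).
Proof.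
move=> z U /nbhs_ballP[e e0 eU]; apply/nbhs_complexP.
exists (e ^+ 2); first by rewrite exprn_gt0.
case: z eU => a b eU [c d]; rewrite /sqmod /= => h; apply: eU => /=.
rewrite /ball /= distrC -(@ltr_pXn2r _ 2)// ?nnegrE ?(ltW e0)// real_normK//.
  by apply: le_lt_trans h; rewrite lerDl sqr_ge0.
exact: num_real.
Qed.

Lemma continuous_Im : continuous (@complex.Im R).
Proof.
move=> z U /nbhs_ballP[e e0 eU]; apply/nbhs_complexP.
exists (e ^+ 2); first by rewrite exprn_gt0.
case: z eU => a b eU [c d]; rewrite /sqmod /= => h; apply: eU => /=.
rewrite /ball /= distrC -(@ltr_pXn2r _ 2)// ?nnegrE ?(ltW e0)// real_normK//.
  by apply: le_lt_trans h; rewrite lerDr sqr_ge0.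
exact: num_real.
Qed.

Lemma continuous_sqmod : continuous (@sqmod R).
Proof.
apply: continuousDf.
  by apply: (@continuousMf _ _ _ _); exact: continuous_Re.
by apply: (@continuousMf _ _ _ _); exact: continuous_Im.
Qed.

Lemma continuous_complex : continuous (fun ab : R * R => ab.1 +i* ab.2).
Proof.
move=> [a b] U /nbhs_complexP[r r0 rU].
have h0 : 0 < r / 2 by lra.
have s0 : 0 < Num.sqrt (r / 2) by rewrite sqrtr_gt0.
apply/nbhs_ballP; exists (Num.sqrt (r / 2)) => // -[c d] [/= ac bd].
apply: rU; rewrite /sqmod /=.
have sqlt (u v : R) : ball u (Num.sqrt (r / 2)) v -> (v - u) ^+ 2 < r / 2.
  rewrite /ball /= distrC => uv.
  rewrite -[X in _ < X]sqr_sqrtr ?(ltW h0)// -real_normK ?num_real//.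
  by rewrite ltr_pXn2r// nnegrE ?(ltW s0).
by have := sqlt _ _ ac; have := sqlt _ _ bd; lra.
Qed.

Lemma compact_sqmod_le r : compact [set z : R[i] | sqmod z <= r].
Proof.
pose I : set R := `[- (r + 1), r + 1]%classic.
pose c (ab : R * R) := ab.1 +i* ab.2.
apply: (@subclosed_compact _ _ (c @` (I `*` I))).
- rewrite (_ : [set _ | _] = @sqmod R @^-1` [set x | x <= r])//.
  apply: preimage_closed; last exact: closed_le.
  by move=> ? _; exact: continuous_sqmod.
- apply: continuous_compact.
    exact/continuous_subspaceT/continuous_complex.
  by apply: compact_setX; exact: segment_compact.
- move=> [a b]; rewrite /sqmod /= => h; exists (a, b) => //.
  have := sqr_ge0 a; have := sqr_ge0 b => b0 a0.
  by split; rewrite /I /= in_itv /=; apply/andP; split; nra.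
Qed.

(** Plays on R[i] * R the role of [sqmod] on R[i]: a continuous function with
    compact sublevel sets, which detects the point at infinity. *)
Definition sqheight (x : R[i] * R) : R := sqmod x.1 + x.2 ^+ 2.

Lemma continuous_sqheight : continuous sqheight.
Proof.
apply: continuousDf => [x|].
  by apply: continuous_comp; [exact: cvg_fst|exact: continuous_sqmod].
by apply: continuousMf => x; exact: cvg_snd.
Qed.

Lemma compact_sqheight_le r : compact [set x | sqheight x <= r].
Proof.
pose I : set R := `[- (r + 1), r + 1]%classic.
apply: (@subclosed_compact _ _ ([set z | sqmod z <= r] `*` I)).
- rewrite (_ : [set _ | _] = sqheight @^-1` [set x | x <= r])//.
  apply: preimage_closed; last exact: closed_le.
  by move=> ? _; exact: continuous_sqheight.
- by apply: compact_setX; [exact: compact_sqmod_le|exact: segment_compact].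
- move=> [z t]; rewrite /sqheight /= => h.
  have := sqmod_ge0 z; have := sqr_ge0 t => t0 z0.
  split; rewrite /I /=; first by lra.
  by rewrite in_itv /=; apply/andP; split; nra.
Qed.

End SquaredModulus.

(** As phi is proper, its sublevel sets are cofinal among the compact sets. *)
Lemma nbhs_infinityP (R : realType) (T : topologicalType) (phi : T -> R)
    (U : set (one_point_compactification T)) :
  continuous phi -> (forall r, compact [set x | phi x <= r]) ->
  nbhs (None : one_point_compactification T) U <->
  U None /\ exists r, forall x, r < phi x -> U (Some x).
Proof.
move=> cphi kphi; split=> [[K [kK _] KU]|[UN [r rU]]].
  split; first by apply: KU; right.
  have : compact (phi @` K).
    by apply: continuous_compact => //; exact: continuous_subspaceT.
  move=> /compact_bounded[M [_ /(_ (M + 1))]].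
  rewrite ltrDl ltr01 => /(_ isT) h.
  exists (M + 1) => x Mx; apply: KU; left; exists x => // Kx.
  have /= := h (phi x) (ex_intro2 _ _ x Kx erefl).
  by move/(le_trans (ler_norm _)); rewrite leNgt Mx.
exists [set x | phi x <= r].
  split; first exact: kphi.
  rewrite (_ : [set _ | _] = phi @^-1` [set x | x <= r])//.
  by apply: preimage_closed; [move=> ? _; exact: cphi|exact: closed_le].
by move=> _ [[x nx <-]|->//]; apply: rU; rewrite ltNge; exact/negP.
Qed.

(** * The chordal metric on the Riemann sphere *)

Section Sphere.
Variable R : realType.
Implicit Types (y : CP1 R) (u v : R[i] * R[i]) (A : 'M[R[i]]_2).

Definition hcoord y : R[i] * R[i] := if y is Some w then (w, 1) else (1, 0).
Definition sqnorm v : R := sqmod v.1 + sqmod v.2.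
Definition area u v : R[i] := u.1 * v.2 - u.2 * v.1.
Definition mxapp A v : R[i] * R[i] :=
  (A 0 0 * v.1 + A 0 1 * v.2, A 1 0 * v.1 + A 1 1 * v.2).
(** The square of the chordal distance. Keeping the square avoids roots, at the
    price of the factor 2 in the triangle inequality. *)
Definition chord y y' : R :=
  sqmod (area (hcoord y) (hcoord y')) /
  (sqnorm (hcoord y) * sqnorm (hcoord y')).

Lemma sqnorm_ge0 v : 0 <= sqnorm v.
Proof. by rewrite addr_ge0 ?sqmod_ge0. Qed.

Lemma sqnorm_hcoord_ge1 y : 1 <= sqnorm (hcoord y).
Proof.
case: y => [w|]; rewrite /sqnorm /= sqmod1 ?sqmod0 ?addr0//.
by rewrite lerDr sqmod_ge0.
Qed.

Lemma sqnorm_hcoord_gt0 y : 0 < sqnorm (hcoord y).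
Proof. by apply: lt_le_trans (sqnorm_hcoord_ge1 y). Qed.

Lemma chordxx y : chord y y = 0.
Proof. by rewrite /chord /area [X in X - _]mulrC subrr sqmod0 mul0r. Qed.

Lemma chordC y y' : chord y y' = chord y' y.
Proof.
rewrite /chord (mulrC (sqnorm _)) -sqmodN; congr (sqmod _ / _).
by rewrite /area; ring.
Qed.

Lemma chord_eq0 y y' : chord y y' = 0 -> y = y'.
Proof.
move/eqP; rewrite mulf_eq0 invr_eq0 mulf_eq0 !(gt_eqF (sqnorm_hcoord_gt0 _)).
rewrite !orbF sqmod_eq0 /area.
case: y => [w|]; case: y' => [w'|] //=.
- by rewrite mulr1 mul1r subr_eq0 => /eqP ->.
- by rewrite mulr0 mulr1 sub0r oppr_eq0 oner_eq0.
- by rewrite mulr1 mul0r subr0 oner_eq0.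
Qed.

(** From the identity v2 [v1, v3] = v3 [v1, v2] + v1 [v2, v3] between vectors of
    C^2, where [., .] is [area]. *)
Lemma chord_triangle y1 y2 y3 :
  chord y1 y3 <= 2 * (chord y1 y2 + chord y2 y3).
Proof.
rewrite /chord; move: (sqnorm_hcoord_gt0 y1) (sqnorm_hcoord_gt0 y2)
  (sqnorm_hcoord_gt0 y3).
case: (hcoord y1) => a b; case: (hcoord y2) => c d; case: (hcoord y3) => e f.
set n1 := sqnorm _ => n1_gt0; set n2 := sqnorm _ => n2_gt0.
set n3 := sqnorm _ => n3_gt0.
set s13 := sqmod _; set s12 := sqmod (area (a, b) (c, d)); set s23 := sqmod _.
have key : n2 * s13 <= 2 * (n3 * s12 + n1 * s23).
  have E1 : c * (a * f - b * e) = e * (a * d - b * c) + a * (c * f - d * e).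
    by ring.
  have E2 : d * (a * f - b * e) = f * (a * d - b * c) + b * (c * f - d * e).
    by ring.
  have := sqmodD (e * (a * d - b * c)) (a * (c * f - d * e)).
  have := sqmodD (f * (a * d - b * c)) (b * (c * f - d * e)).
  rewrite -E1 -E2 !sqmodM /n1 /n2 /n3 /s12 /s23 /s13 /sqnorm /area /=.
  by lra.
have -> : s13 / (n1 * n3) = (n2 * s13) / (n1 * n2 * n3).
  by field; rewrite !gt_eqF.
have -> : 2 * (s12 / (n1 * n2) + s23 / (n2 * n3)) =
    (2 * (n3 * s12 + n1 * s23)) / (n1 * n2 * n3).
  by field; rewrite !gt_eqF.
by rewrite ler_pM2r// invr_gt0 !mulr_gt0.
Qed.

Lemma nbhs_CP1_Some (w : R[i]) (U : set (CP1 R)) :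
  nbhs (Some w : CP1 R) U <->
  exists2 r : R, 0 < r & forall w', sqmod (w' - w) < r -> U (Some w').
Proof. exact: nbhs_complexP. Qed.

Lemma nbhs_CP1_None (U : set (CP1 R)) :
  nbhs (None : CP1 R) U <->
  U None /\ exists r, forall w, r < sqmod w -> U (Some w).
Proof.
apply: nbhs_infinityP; first exact: continuous_sqmod.
exact: compact_sqmod_le.
Qed.

Lemma chord_SomeE (w w' : R[i]) : chord (Some w) (Some w') =
  sqmod (w - w') / ((sqmod w + 1) * (sqmod w' + 1)).
Proof. by rewrite /chord /area /sqnorm /= sqmod1 mulr1 mul1r. Qed.

Lemma chord_NoneE (w : R[i]) : chord None (Some w) = (sqmod w + 1)^-1.
Proof.
by rewrite /chord /area /sqnorm /= sqmod0 addr0 mulr1 mul0r subr0 sqmod1 !mul1r.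
Qed.

Lemma nbhs_chord_ball y (e : R) : 0 < e -> \forall y' \near y, chord y y' < e.
Proof.
move=> e0; case: y => [w|].
  apply/nbhs_CP1_Some; exists e => // w' ww'; rewrite chord_SomeE sqmodBC.
  apply: le_lt_trans ww'; rewrite ler_pdivrMr; last first.
    by rewrite mulr_gt0// ltr_wpDl ?sqmod_ge0.
  rewrite ler_peMr ?sqmod_ge0//.
  by have := sqmod_ge0 w; have := sqmod_ge0 w'; nra.
apply/nbhs_CP1_None; split; first by rewrite chordxx.
exists e^-1 => w' ew'; rewrite chord_NoneE invf_plt ?posrE//.
  by rewrite ltr_wpDr.
by rewrite ltr_wpDl ?sqmod_ge0.
Qed.

Lemma chord_ball_nbhs y (U : set (CP1 R)) : nbhs y U ->
  exists2 e : R, 0 < e & forall y', chord y y' < e -> U y'.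
Proof.
case: y => [w|] yU.
  have /nbhs_CP1_Some[r r0 rU] := yU.
  pose c := sqmod w + 1.
  have c1 : 1 <= c by rewrite lerDr sqmod_ge0.
  have c0 : 0 < c := lt_le_trans ltr01 c1.
  (* This e makes e * c * (2 * s + 2 * c) <= s equivalent to r <= s, which is
     how s = sqmod (w - w') gets bounded by r below. *)
  pose e := r / (2 * c * (r + c)).
  have d0 : 0 < 2 * c * (r + c) by nra.
  have e0 : 0 < e by rewrite divr_gt0.
  have ec : e * c * 2 * (r + c) = r.
    rewrite /e -[RHS](divfK (lt0r_neq0 d0)); ring.
  have ec0 : 0 < e * c by rewrite mulr_gt0.
  exists e => // -[w'|]; last first.
    rewrite chordC chord_NoneE => h; exfalso.
    have : 1 < e * c.
      by rewrite -(ltr_pdivrMr _ _ c0) mul1r.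
    by rewrite -/c; nra.
  rewrite chord_SomeE ltr_pdivrMr; last first.
    by rewrite mulr_gt0// ltr_wpDl ?sqmod_ge0.
  rewrite -/c => h; apply: rU; rewrite sqmodBC.
  have := sqmodD (w' - w) w; rewrite subrK sqmodBC.
  move: h; have := sqmod_ge0 (w - w').
  move: (sqmod (w - w')) (sqmod w') => s q s0 h hq.
  have cE : sqmod w = c - 1 by rewrite /c; ring.
  rewrite cE in hq; clear cE; clearbody e c.
  rewrite ltNge; apply/negP => rs.
  have : s < e * c * (2 * s + 2 * c).
    apply: lt_le_trans h _; rewrite mulrA ler_pM2l//; lra.
  have : s * (r + c) >= r * (s + c) by nra.
  nra.
have /nbhs_CP1_None[UN [r rU]] := yU.
pose e := (`|r| + 1)^-1; have e0 : 0 < e by rewrite invr_gt0 ltr_wpDl.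
exists e => // -[w'|//]; rewrite chord_NoneE => h.
have w'0 := sqmod_ge0 w'; have r0 := normr_ge0 r; have := ler_norm r.
move: h; rewrite /e ltf_pV2 ?posrE; [move=> h rr; apply: rU; lra|lra|lra].
Qed.

Lemma connected_segments (A : set R[i]) (z : R[i]) : A z ->
  (forall w, A w -> forall t : R, 0 <= t <= 1 -> A (z + t%:C * (w - z))) ->
  connected A.
Proof.
move=> Az hA.
have -> : A = \bigcup_(w in A) ((fun t : R => z + t%:C * (w - z)) @` `[0, 1]).
  apply/seteqP; split=> [w Aw|_ [w Aw [t + <-]]].
    exists w => //; exists 1; last by rewrite mul1r subrKC.
    by rewrite /= in_itv /= ler01 lexx.
  by rewrite /= in_itv /=; exact: hA.
apply: bigcup_connected.
  exists z => w Aw; exists 0; first by rewrite /= in_itv /= ler01 lexx.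
  by rewrite mul0r addr0.
move=> w Aw; apply: connected_continuous_connected.
  by apply/connected_intervalP; exact: interval_is_interval.
apply: continuous_subspaceT => t.
case: z w {Az hA Aw} => a b [c d].
have -> : (fun t0 : R => (a +i* b) + t0%:C * ((c +i* d) - (a +i* b))) =
    (fun ab : R * R => ab.1 +i* ab.2) \o
    (fun t0 : R => (a + t0 * (c - a), b + t0 * (d - b))).
  apply/funext => s /=; apply/eqP; rewrite eq_complex /=.
  by apply/andP; split; apply/eqP; ring.
apply: continuous_comp; last exact: continuous_complex.
have ca (u v : R) : continuous (fun s : R => u + s * v).
  apply: continuousDf; first exact: continuous_cstf.
  by apply: continuousMf => ?; [exact: cvg_id|exact: cvg_cst].
exact: (cvg_pair (ca _ _ t) (ca _ _ t)).
Qed.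

Lemma connected_disk (z : R[i]) (r : R) :
  connected [set w | sqmod (w - z) < r].
Proof.
have [r0|r0] := leP r 0.
  rewrite (_ : [set _ | _] = set0); first exact: connected0.
  apply/seteqP; split=> // w /= h.
  by have := sqmod_ge0 (w - z); lra.
apply: (@connected_segments _ z); first by rewrite /= subrr sqmod0.
move=> w /= wr t /andP[t0 t1].
rewrite addrC addKr sqmodM sqmodC; apply: le_lt_trans wr.
by rewrite ler_piMl ?sqmod_ge0//; nra.
Qed.

(** The inversion w |-> 1 / w is a chart at infinity; it makes punctured
    neighbourhoods of infinity connected images of disks. *)
Definition cinv (w : R[i]) : CP1 R := if w == 0 then None else Some w^-1.

Lemma continuous_cinv : continuous cinv.
Proof.
move=> w U; rewrite /cinv; case: eqVneq => [->|w0].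
  move=> /nbhs_CP1_None[UN [r rU]]; apply/nbhs_complexP.
  exists (`|r| + 1)^-1; first by rewrite invr_gt0 ltr_wpDl.
  move=> w'; rewrite subr0 => h /=; case: eqVneq => // w'0; apply: rU.
  rewrite sqmodV; apply: le_lt_trans (ler_norm r) _.
  rewrite -(@ltrD2r _ 1) -[ltLHS]invrK.
  have sw : 0 < sqmod w' by rewrite lt0r sqmod_eq0 w'0 sqmod_ge0.
  have : (`|r| + 1)^-1^-1 < (sqmod w')^-1.
    by rewrite ltf_pV2// posrE invr_gt0 ltr_wpDl.
  by lra.
move=> wU; have nw : \forall w' \near w, w' != 0.
  apply/nbhs_complexP; exists (sqmod w).
    by rewrite lt0r sqmod_eq0 w0 sqmod_ge0.
  by move=> w' h; apply/eqP => w'0; move: h; rewrite w'0 sub0r sqmodN ltxx.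
have /(@inv_continuous _ _ w0) wU' : nbhs w^-1 (fun z => U (Some z)).
  exact: wU.
change (\forall w' \near w, U (if w' == 0 then None else Some w'^-1)).
by apply: filterS2 nw wU' => w' /negbTE -> .
Qed.

Lemma open_sqmod_lt (z : R[i]) (r : R) : open [set w | sqmod (w - z) < r].
Proof.
rewrite openE => w /= wr.
have c : continuous (fun x : R[i] => sqmod (x - z)).
  rewrite (_ : (fun x => _) = fun x : R[i] =>
      (complex.Re x - complex.Re z) * (complex.Re x - complex.Re z) +
      (complex.Im x - complex.Im z) * (complex.Im x - complex.Im z));
      last first.
    by apply/funext => -[a b]; case: (z) => a' b'; rewrite /sqmod /=; ring.
  have cR : continuous (fun x : R[i] => complex.Re x - complex.Re z).
    by apply: continuousBf; [exact: continuous_Re|exact: continuous_cstf].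
  have cI : continuous (fun x : R[i] => complex.Im x - complex.Im z).
    by apply: continuousBf; [exact: continuous_Im|exact: continuous_cstf].
  by apply: continuousDf; exact: continuousMf.
change (\forall x \near w, sqmod (x - z) < r).
have /cvgr_lt := c w; exact.
Qed.

Lemma CP1_locally_connected y (U : set (CP1 R)) : nbhs y U ->
  exists N, [/\ open N, connected N, N y & N `<=` U].
Proof.
case: y => [w|] yU.
  have /nbhs_CP1_Some[r r0 rU] := yU.
  exists (Some @` [set w' | sqmod (w' - w) < r]); split.
  - exact/one_point_compactification_open_some/open_sqmod_lt.
  - apply: connected_continuous_connected; first exact: connected_disk.
    apply: continuous_subspaceT.
    exact: one_point_compactification_some_continuous.
  - by exists w => //=; rewrite subrr sqmod0.
  - by move=> _ [w' h <-]; exact: rU.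
have /nbhs_CP1_None[UN [r rU]] := yU.
have r1 : 0 < `|r| + 1 by rewrite ltr_wpDl.
pose s := (`|r| + 1)^-1; have s0 : 0 < s by rewrite invr_gt0.
have sV (w : R[i]) : w != 0 -> (sqmod w < s) = (`|r| + 1 < sqmod w^-1).
  move=> w0; rewrite sqmodV -[in RHS](invrK (`|r| + 1)) ltf_pV2 ?posrE//.
  by rewrite lt0r sqmod_eq0 w0 sqmod_ge0.
have far w : `|r| + 1 < sqmod w ->
    (cinv @` [set w' | sqmod (w' - 0) < s]) (Some w).
  move=> rw; have w0 : w != 0.
    by apply/eqP => w0; move: rw; rewrite w0 sqmod0 ltNge (ltW r1).
  exists w^-1; last by rewrite /cinv invr_eq0 (negbTE w0) invrK.
  by rewrite /= subr0 sV ?invr_eq0// invrK.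
exists (cinv @` [set w' | sqmod (w' - 0) < s]); split.
- rewrite openE => _ [w /= ws <-]; rewrite subr0 in ws; rewrite /cinv.
  case: eqVneq => [_|w0].
    apply/nbhs_CP1_None; split; last by exists (`|r| + 1).
    by exists 0; rewrite /= ?subrr ?sqmod0// /cinv eqxx.
  rewrite sV// in ws.
  apply: (@filterS _ _ _ (Some @` [set w' | `|r| + 1 < sqmod w'])).
    by move=> _ [w' /= rw' <-]; exact: far.
  apply: one_point_compactification_some_nbhs.
  change (\forall x \near w^-1, `|r| + 1 < sqmod x).
  have /cvgr_gt := @continuous_sqmod R w^-1; exact.
- apply: connected_continuous_connected; first exact: connected_disk.
  exact/continuous_subspaceT/continuous_cinv.
- by exists 0; rewrite /= ?subrr ?sqmod0// /cinv eqxx.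
- move=> _ [w /= ws <-]; rewrite subr0 in ws; rewrite /cinv.
  case: eqVneq => [//|w0]; apply: rU; rewrite sV// in ws.
  by have := ler_norm r; lra.
Qed.

End Sphere.

(** * Moebius transformations and hyperbolic space *)

Section Mobius.
Variable R : realType.
Implicit Types (y : CP1 R) (v : R[i] * R[i]) (A : 'M[R[i]]_2).
Implicit Types (x : R[i] * R) (u : PSL2 R) (G : set (PSL2 R)).

Lemma det2E A : \det A = A 0 0 * A 1 1 - A 0 1 * A 1 0.
Proof.
rewrite (expand_det_row _ 0) !big_ord_recl big_ord0 addr0 /cofactor !det_mx11.
rewrite !mxE /= expr0 expr1 mul1r mulN1r mulrN.
by congr (A _ _ * A _ _ - A _ _ * A _ _); apply/val_inj.
Qed.

Lemma area_mxapp A v v' :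
  area (mxapp A v) (mxapp A v') = \det A * area v v'.
Proof. by rewrite det2E /area /mxapp /=; ring. Qed.

Lemma hcoord_mobius A y : \det A = 1 ->
  exists2 l : R[i], l != 0 & mxapp A (hcoord y) =
    (l * (hcoord (mobius A y)).1, l * (hcoord (mobius A y)).2).
Proof.
rewrite det2E => dA; rewrite /mxapp; case: y => [w|] /=.
  case: (eqVneq (A 1 0 * w + A 1 1) 0) => [den0|den0].
    exists (A 0 0 * w + A 0 1); last by rewrite /= !mulr1 mulr0 den0.
    apply/eqP => num0; have /eqP := oner_neq0 R[i]; apply; rewrite -dA.
    have : A 0 0 * (A 1 0 * w + A 1 1) - A 1 0 * (A 0 0 * w + A 0 1) = 0.
      by rewrite den0 num0 !mulr0 subrr.
    by move=> <-; ring.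
  exists (A 1 0 * w + A 1 1) => //=.
  by rewrite !mulr1 (mulrC (A 1 0 * w + A 1 1)) divfK.
rewrite !mulr1 !mulr0 !addr0.
case: (eqVneq (A 1 0) 0) => [c0|c0].
  exists (A 0 0); last by rewrite /= mulr1 mulr0 c0.
  apply/eqP => a0; have /eqP := oner_neq0 R[i]; apply; rewrite -dA.
  by rewrite a0 c0 mul0r mulr0 subrr.
by exists (A 1 0) => //=; rewrite mulr1 mulrC divfK.
Qed.

(** The numerator of [chord] is invariant because A preserves [area], so A
    changes the chordal metric only through the norms of the coordinate
    vectors. *)
Lemma chord_mobius A y y' : \det A = 1 ->
  chord (mobius A y) (mobius A y') =
  sqmod (area (hcoord y) (hcoord y')) /
  (sqnorm (mxapp A (hcoord y)) * sqnorm (mxapp A (hcoord y'))).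
Proof.
move=> dA; rewrite -[area (hcoord y) _]mul1r -dA -area_mxapp.
have [l l0 ->] := hcoord_mobius y dA.
have [m m0 ->] := hcoord_mobius y' dA.
rewrite /chord /sqnorm /= !sqmodM -!mulrDr.
set a := area _ _; set b := area _ _.
have -> : b = l * m * a by rewrite /a /b /area /=; ring.
have := sqnorm_hcoord_gt0 (mobius A y); have := sqnorm_hcoord_gt0 (mobius A y').
rewrite /sqnorm; set n := _ + _ => n0; set n' := _ + _ => n0'.
have sl : sqmod l != 0 by rewrite sqmod_eq0.
have sm : sqmod m != 0 by rewrite sqmod_eq0.
rewrite !sqmodM; field.
by rewrite sl sm !gt_eqF.
Qed.

Lemma mobius_inj A : \det A = 1 -> injective (mobius A).
Proof.
move=> dA y y' yy'; apply: chord_eq0.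
have := chordxx (mobius A y); rewrite {2}yy' chord_mobius//.
have pos z : sqnorm (mxapp A (hcoord z)) != 0.
  have [l l0 ->] := hcoord_mobius z dA.
  rewrite /sqnorm /= !sqmodM -mulrDr mulf_neq0 ?sqmod_eq0//.
  exact/lt0r_neq0/sqnorm_hcoord_gt0.
move/eqP; rewrite mulf_eq0 invr_eq0 mulf_eq0 !(negbTE (pos _)) !orbF.
by rewrite /chord => /eqP ->; rewrite mul0r.
Qed.

(** The points (z, t) of hyperbolic space are the positive Hermitian forms of
    determinant 1 on C^2: this is the form of (z, t). That of (0, 1) is
    [sqnorm]. *)
Definition hform x v : R := sqmod (v.1 - x.1 * v.2) / x.2 + x.2 * sqmod v.2.

Lemma poincare_ext_gt0 A x : \det A = 1 -> 0 < x.2 -> 0 < (poincare_ext A x).2.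
Proof.
case: x => z t /= dA t0; rewrite divr_gt0//.
have [c0|c0] := eqVneq (A 1 0) 0.
  rewrite c0 mul0r add0r sqmod0 mul0r addr0 lt0r sqmod_ge0 sqmod_eq0 andbT.
  apply/eqP => d0; have /eqP := oner_neq0 R[i]; apply; rewrite -dA det2E.
  by rewrite c0 d0 !mulr0 subrr.
apply: ltr_wpDl; first exact: sqmod_ge0.
by rewrite mulr_gt0 ?exprn_gt0// lt0r sqmod_eq0 c0 sqmod_ge0.
Qed.

(** The identification of points with forms is equivariant for SL(2, C), which
    turns the Poincare extension into linear algebra. With
    w = v1 - z v2, the first coordinate of A v minus the new centre times the
    second is (conj den w - conj c t^2 v2) / n; the rest is Lagrange's
    identity. *)
Lemma hform_mxapp A x v : \det A = 1 -> 0 < x.2 ->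
  hform (poincare_ext A x) (mxapp A v) = hform x v.
Proof.
move=> dA; have := poincare_ext_gt0 dA; case: x => z t /= pos t0.
have {pos} := pos (z, t) t0; rewrite /=.
case: v => v1 v2; rewrite /hform /mxapp /=; rewrite det2E in dA.
move: dA; move: (A 0 0) (A 0 1) (A 1 0) (A 1 1) => a b c d dA.
set num := a * z + b; set den := c * z + d.
set n := sqmod den + _ => tn0.
have n0 : 0 < n by move: tn0; rewrite pmulr_rgt0// invr_gt0.
have nC : n%:C = den * conjc den + c * conjc c * (t ^+ 2)%:C.
  rewrite /n; case: (den) => p q; case: (c) => p' q'; rewrite /sqmod.
  by apply/eqP; rewrite eq_complex /=; apply/andP; split; apply/eqP; ring.
have nC0 : n%:C != 0 by rewrite eq_complex /= eqxx andbT gt_eqF.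
pose w := v1 - z * v2.
have e2 : c * v1 + d * v2 = c * w + den * v2 by rewrite /w /den; ring.
have e1 : a * v1 + b * v2 = a * w + num * v2 by rewrite /w /num; ring.
have dd : a * den - c * num = 1 by rewrite -dA /num /den; ring.
rewrite e1 e2.
have -> : a * w + num * v2 -
    (num * conjc den + a * conjc c * (t ^+ 2)%:C) / n%:C * (c * w + den * v2) =
    (conjc den * w - conjc c * (t ^+ 2)%:C * v2) / n%:C.
  apply: (mulIf nC0); rewrite mulrBl divfK// mulrAC divfK// nC.
  rewrite -[RHS]mul1r -dd; ring.
rewrite sqmodM sqmodV sqmodC.
have key : sqmod (conjc den * w - conjc c * (t ^+ 2)%:C * v2) +
    t ^+ 2 * sqmod (c * w + den * v2) = n * (sqmod w + t ^+ 2 * sqmod v2).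
  rewrite /n; case: (den) => d1 d2; case: (c) => c1 c2; case: (w) => w1 w2.
  by case: (v2) => p q; rewrite /sqmod /=; ring.
have -> : sqmod (conjc den * w - conjc c * (t ^+ 2)%:C * v2) =
    n * (sqmod w + t ^+ 2 * sqmod v2) - t ^+ 2 * sqmod (c * w + den * v2).
  by rewrite -key addrK.
by field; rewrite !gt_eqF.
Qed.

(** Passing from the base point (0, 1) to another one x costs only a constant.
    *)
Lemma hform_ge x : 0 < x.2 ->
  exists2 k : R, 0 < k & forall v, k * sqnorm v <= hform x v.
Proof.
case: x => z t /= t0; pose s := sqmod z; have s0 : 0 <= s by exact: sqmod_ge0.
exists (2 * t + (2 * s + 1) / t)^-1.
  by rewrite invr_gt0 addr_gt0 ?mulr_gt0 ?invr_gt0//; lra.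
case=> v1 v2; rewrite /hform /sqnorm /=.
have := sqmodD (v1 - z * v2) (z * v2); rewrite subrK sqmodM -/s.
have := sqmod_ge0 (v1 - z * v2); have := sqmod_ge0 v2.
move: (sqmod (_ - _)) (sqmod v1) (sqmod v2) => p q r r0 p0 pq.
have D0 : 0 < 2 * t + (2 * s + 1) / t.
  by rewrite addr_gt0 ?mulr_gt0 ?invr_gt0//; lra.
rewrite ler_pdivrMl//.
have -> : (2 * t + (2 * s + 1) / t) * (p / t + t * r) =
   2 * p + 2 * t ^+ 2 * r + (2 * s + 1) * p / t ^+ 2 + (2 * s + 1) * r.
  by field; rewrite gt_eqF.
have : 0 <= 2 * t ^+ 2 * r by rewrite !mulr_ge0 ?(ltW t0).
have : 0 <= (2 * s + 1) * p / t ^+ 2.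
  by rewrite divr_ge0 ?sqr_ge0// mulr_ge0//; lra.
nra.
Qed.

Lemma mxapp_inv A v : A \in unitmx -> mxapp (invmx A) (mxapp A v) = v.
Proof.
move=> uA; have := mulVmx uA => /matrixP E.
have := E 0 0; have := E 0 1; have := E 1 0; have := E 1 1.
rewrite !mxE !big_ord_recl !big_ord0 !addr0 /=.
have -> : lift ord0 ord0 = 1 :> 'I_2 by apply/val_inj.
move=> e11 e10 e01 e00; case: v => v1 v2; rewrite /mxapp /=.
congr (_, _).
  transitivity ((invmx A 0 0 * A 0 0 + invmx A 0 1 * A 1 0) * v1 +
     (invmx A 0 0 * A 0 1 + invmx A 0 1 * A 1 1) * v2); first by ring.
  by rewrite e00 e01 mul1r mul0r addr0.
transitivity ((invmx A 1 0 * A 0 0 + invmx A 1 1 * A 1 0) * v1 +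
     (invmx A 1 0 * A 0 1 + invmx A 1 1 * A 1 1) * v2); first by ring.
by rewrite e10 e11 mul1r mul0r add0r.
Qed.

Definition psl2_mx u : 'M[R[i]]_2 := val (repr u).

Lemma det_psl2_mx u : \det (psl2_mx u) = 1.
Proof. by rewrite /psl2_mx; exact/eqP/(valP (repr u)). Qed.

Lemma hform_psl2_inv u x v : 0 < x.2 ->
  hform (psl2_act3 (psl2_inv u) x) v = hform x (mxapp (psl2_mx u) v).
Proof.
move=> x0; rewrite /psl2_inv psl2_act3_class /=.
have uA : psl2_mx u \in unitmx by rewrite unitmxE det_psl2_mx unitr1.
rewrite -[in LHS](mxapp_inv v uA) hform_mxapp//.
by rewrite det_inv det_psl2_mx invr1.
Qed.

(** The ratio of the two norms is the inverse of the chordal derivative of u at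
    y: the derivatives at y of the elements of G are at most k^-1. *)
Definition uniformly_expanded G (k : R) y := forall u, G u ->
  k * sqnorm (hcoord y) <= sqnorm (mxapp (psl2_mx u) (hcoord y)).

End Mobius.

(** * Equicontinuity on the domain of discontinuity *)

Section Domain.
Variable R : realType.
Implicit Types (y : CP1 R) (v : R[i] * R[i]) (A : 'M[R[i]]_2).
Implicit Types (x : R[i] * R) (u : PSL2 R) (G : set (PSL2 R)).

Lemma nbhs_ball3_Some (z : R[i]) (t : R) (U : set (ball3 R)) :
  nbhs (Some (z, t) : ball3 R) U <->
  exists2 e : R, 0 < e & forall z' t', sqmod (z' - z) < e ^+ 2 ->
    `|t' - t| < e -> U (Some (z', t')).
Proof.
split=> [[[P Q] /= [/nbhs_complexP[r r0 rP] /nbhs_ballP[d /= d0 dQ]] PQ]|].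
  pose e := Num.min (Num.sqrt r) d.
  have e0 : 0 < e by rewrite lt_min sqrtr_gt0 r0.
  exists e => // z' t' zz' tt'; apply: (PQ (z', t')); split => /=.
    apply: rP; apply: lt_le_trans zz' _; rewrite -[leRHS](sqr_sqrtr (ltW r0)).
    by rewrite ler_pXn2r// ?nnegrE ?(ltW e0) ?sqrtr_ge0// ge_min lexx.
  apply: dQ; rewrite /ball /= distrC; apply: lt_le_trans tt' _.
  by rewrite ge_min lexx orbT.
case=> e e0 eU.
exists ([set z' | sqmod (z' - z) < e ^+ 2], ball t e) => /=.
  split; last exact: nbhsx_ballx.
  by apply/nbhs_complexP; exists (e ^+ 2) => //; exact: exprn_gt0.
by move=> [z' t'] [/= zz' tt']; apply: eU => //; rewrite distrC.
Qed.

Lemma nbhs_ball3_None (U : set (ball3 R)) :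
  nbhs (None : ball3 R) U <->
  U None /\ exists r, forall x, r < sqheight x -> U (Some x).
Proof.
apply: nbhs_infinityP; first exact: continuous_sqheight.
exact: compact_sqheight_le.
Qed.

Lemma not_limit_set G y x : H3 x -> ~ limit_set G y ->
  exists2 U, nbhs (CP1_to_ball y) U &
    forall u, G u -> ~ U (H3_to_ball (psl2_act3 u x)).
Proof.
move=> x0 /forall2NP /(_ x)[//|] /existsNP[U /not_implyP[yU nU]].
exists U => // u Gu Uu; apply: nU; exists (H3_to_ball (psl2_act3 u x)).
split=> //; last by exists (psl2_act3 u x) => //; exists u.
case: y {yU} => [w|] //; apply/eqP => -[E].
have : 0 < (psl2_act3 u x).2 by apply: poincare_ext_gt0; rewrite ?det_psl2_mx.
by rewrite E ltxx.
Qed.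

(** |A h|^2 is the value at h of the form of the orbit point A^-1 (j) = (z, t),
    which stays out of a fixed neighbourhood of y in the closed ball. For h over
    the finite point w' this value is |w' - z|^2 / t + t, and it is small only
    if (z, t) is close to (w', 0). *)
Lemma near_uniformly_expanded G y :
  (forall u, G u -> G (psl2_inv u)) -> domain_of_discontinuity G y ->
  exists2 k : R, 0 < k & \forall y' \near y, uniformly_expanded G k y'.
Proof.
move=> GV Gy; pose j : R[i] * R := (0, 1).
have j0 : H3 j by exact: ltr01.
have [U yU nU] := not_limit_set j0 Gy.
have hU u v : G u -> exists x, [/\ 0 < x.2, ~ U (Some x) &
    sqnorm (mxapp (psl2_mx u) v) = hform x v].
  move=> Gu; exists (psl2_act3 (psl2_inv u) j); split.
  - by apply: poincare_ext_gt0; rewrite ?det_psl2_mx.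
  - by apply: nU; exact: GV.
  - rewrite hform_psl2_inv//.
    by rewrite /hform /sqnorm /= mul0r subr0 divr1 mul1r.
case: y {Gy} yU => [w|] yU.
  have /nbhs_ball3_Some[e e0 eU] := yU.
  pose D := 2 * sqmod w + e ^+ 2 / 2 + 1.
  have D0 : 0 < D.
    by have := sqmod_ge0 w; have := sqr_ge0 e; rewrite /D; lra.
  exists (e / 4 / D); first by rewrite !divr_gt0.
  apply/nbhs_CP1_Some; exists (e ^+ 2 / 4).
    by rewrite divr_gt0 ?exprn_gt0.
  move=> w' ww' u Gu.
  have [[z t] [/= t0 nUx ->]] := hU u (hcoord (Some w')) Gu.
  apply: (@le_trans _ _ (e / 4)).
    rewrite -[leRHS](divfK (lt0r_neq0 D0)) ler_pM2l ?divr_gt0//.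
    rewrite /sqnorm /= sqmod1 /D.
    by have := sqmodD (w' - w) w; rewrite subrK; lra.
  rewrite /hform /= sqmod1 !mulr1.
  have q0 := sqmod_ge0 (w' - z).
  have [et|te] := leP e t.
    have : 0 <= sqmod (w' - z) / t by rewrite divr_ge0// ltW.
    lra.
  have : ~ (sqmod (z - w) < e ^+ 2).
    by move=> zw; apply: nUx; apply: eU => //; rewrite subr0 gtr0_norm.
  move=> /negP; rewrite -leNgt => zw.
  have := sqmodD (z - w') (w' - w); rewrite subrKA (sqmodBC z w') => zw'.
  have qe : e ^+ 2 / 4 <= sqmod (w' - z) by lra.
  have : e / 4 <= sqmod (w' - z) / t.
    rewrite ler_pdivlMr//; apply: le_trans qe; nra.
  lra.
have /nbhs_ball3_None[_ [r rU]] := yU.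
pose M : R := `|r| + 1.
have M1 : 1 <= M by rewrite lerDr.
have M0 : 0 < M := lt_le_trans ltr01 M1.
have hM x : ~ U (Some x) -> sqheight x <= M.
  move=> nUx; rewrite leNgt; apply/negP => Mx; apply: nUx; apply: rU.
  by apply: le_lt_trans Mx; have := ler_norm r; rewrite /M; lra.
clearbody M.
exists (8 * M)^-1; first by rewrite invr_gt0 mulr_gt0.
have ht x : 0 < x.2 -> ~ U (Some x) -> x.2 <= M.
  case: x => z t /= t0 /hM; rewrite /sqheight /=.
  have := sqmod_ge0 z; nra.
apply/nbhs_CP1_None; split.
  move=> u Gu; have [[z t] [/= t0 nUx ->]] := hU u (hcoord None) Gu.
  have := ht (z, t) t0 nUx; rewrite /hform /sqnorm /= => tM.
  rewrite sqmod1 sqmod0 mulr0 subr0 sqmod1 mulr0 !addr0 mulr1 mul1r.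
  by rewrite lef_pV2 ?posrE ?mulr_gt0//; lra.
exists (4 * M) => w Mw u Gu.
have [[z t] [/= t0 nUx ->]] := hU u (hcoord (Some w)) Gu.
have := ht (z, t) t0 nUx; have := hM _ nUx; rewrite /hform /sqnorm /sqheight /=.
rewrite sqmod1 !mulr1 => ztM tM.
have := sqmodD (w - z) z; rewrite subrK => wz.
have q0 := sqmod_ge0 (w - z).
have : (8 * M)^-1 * (sqmod w + 1) <= sqmod (w - z) / t.
  rewrite ler_pdivlMr// mulrAC -mulrA mulrC ler_pdivrMr ?mulr_gt0//.
  have := sqr_ge0 t => t2.
  have : sqmod w <= 4 * sqmod (w - z) by lra.
  nra.
lra.
Qed.

(** Suppose orbit points (z, t) converge to y. The form of (z, t) takes the
    value t on the vector over z, and t^-1 on the vector over infinity. If y is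
    finite, then z is near y while t tends to 0, against the lower bound over
    z. If y is infinite, the bound over infinity keeps t bounded, so z tends to
    infinity, and the bound over z fails. The neighbourhood of y matters: at y
    alone, the form may stay bounded below when the orbit approaches y
    tangentially. *)
Lemma uniformly_expanded_domain G (k : R) y : 0 < k ->
  (forall u, G u -> G (psl2_inv u)) ->
  (\forall y' \near y, uniformly_expanded G k y') ->
  domain_of_discontinuity G y.
Proof.
move=> k0 GV yk [x x0 lim].
have [m m0 hm] := hform_ge x0.
pose c := m * k; have c0 : 0 < c by rewrite mulr_gt0.
have hc u y' : G u -> uniformly_expanded G k y' ->
    c * sqnorm (hcoord y') <= hform (psl2_act3 u x) (hcoord y').
  move=> Gu ey'.
  have -> : u = psl2_inv (psl2_inv u).
    by elim/psl2_ind: u {Gu} => A; rewrite !psl2_inv_class; congr psl2_class;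
      apply/val_inj; rewrite /= invmxK.
  rewrite hform_psl2_inv//; apply: le_trans (hm _).
  by rewrite /c -mulrA ler_pM2l//; apply: ey'; exact: GV.
have pos u : 0 < (psl2_act3 u x).2.
  by apply: poincare_ext_gt0; rewrite ?det_psl2_mx.
case: y yk lim => [w|] yk lim.
  have /nbhs_CP1_Some[r r0 rk] := yk.
  pose e := Num.min (Num.sqrt r) c.
  have e0 : 0 < e by rewrite lt_min sqrtr_gt0 r0.
  have /lim[_ [_ [_ [u Gu <-] <-]]] : nbhs (Some (w, 0) : ball3 R)
      (Some @` [set x' | sqmod (x'.1 - w) < e ^+ 2 /\ `|x'.2| < e]).
    apply/nbhs_ball3_Some; exists e => // z' t' zz' tt'.
    by exists (z', t') => //=; rewrite subr0 in tt'.
  move: (hc u) (pos u); case: (psl2_act3 u x) => z t /= hz t0.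
  move=> [[z' t'] /= [zw te] [zz tt]]; subst z' t'.
  have := hz (Some z) Gu; rewrite /hform /sqnorm /= mulr1 subrr sqmod0 sqmod1.
  rewrite mul0r add0r mulr1 => h.
  have : uniformly_expanded G k (Some z).
    apply: rk; apply: lt_le_trans zw _; rewrite -[leRHS](sqr_sqrtr (ltW r0)).
    by rewrite ler_pXn2r// ?nnegrE ?(ltW e0) ?sqrtr_ge0// ge_min lexx.
  move/h; have := sqmod_ge0 z; move: te; rewrite gtr0_norm// lt_min => /andP[_].
  nra.
have /nbhs_CP1_None[kN [r rk]] := yk.
pose M := `|r| + 2 * c^-1 ^+ 2.
have /lim[_ [_ [_ [u Gu <-] <-]]] : nbhs (None : ball3 R)
    ([set None] `|` Some @` [set x' | M < sqheight x']).
  apply/nbhs_ball3_None; split; first by left.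
  by exists M => x' Mx'; right; exists x'.
move: (hc u) (pos u); case: (psl2_act3 u x) => z t /= hz t0.
move=> [//|[[z' t'] /= Mx [zz tt]]]; subst z' t'.
have := hz None Gu kN; rewrite /hform /sqnorm /=.
rewrite sqmod1 sqmod0 mulr0 subr0 sqmod1 mulr0 !addr0 mulr1 mul1r => ct.
have tc : t <= c^-1 by rewrite -[t]invrK lef_pV2// posrE invr_gt0.
have c'0 : 0 < c^-1 by rewrite invr_gt0.
have t2 : t ^+ 2 <= c^-1 ^+ 2 by rewrite ler_pXn2r// nnegrE ltW.
have rn := ler_norm r; have r0 := normr_ge0 r.
move: Mx; rewrite /sqheight /M /= => Mx.
have /(hz (Some z) Gu) : uniformly_expanded G k (Some z).
  by apply: rk; have := sqr_ge0 c^-1; lra.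
rewrite /hform /sqnorm /= mulr1 subrr sqmod0 sqmod1 mul0r add0r mulr1.
have : c * c^-1 = 1 by rewrite mulfV// gt_eqF.
have : c^-1 ^+ 2 < sqmod z by have := sqr_ge0 c^-1; lra.
rewrite expr2; nra.
Qed.

(** Uniform expansion near y is an open condition on y. *)
Lemma open_domain_of_discontinuity G : (forall u, G u -> G (psl2_inv u)) ->
  open (domain_of_discontinuity G).
Proof.
move=> GV; rewrite openE => y Gy.
have [k k0 yk] := near_uniformly_expanded GV Gy.
have := nbhs_interior yk; apply: filterS => y' yk'.
exact: uniformly_expanded_domain yk'.
Qed.

Lemma uniformly_expanded_chord G (k : R) u y y' : 0 < k -> G u ->
  uniformly_expanded G k y -> uniformly_expanded G k y' ->
  chord (psl2_act u y) (psl2_act u y') <= chord y y' / k ^+ 2.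
Proof.
move=> k0 Gu /(_ u Gu) ey /(_ u Gu) ey'.
rewrite /psl2_act chord_mobius ?det_psl2_mx// /chord -/(psl2_mx u).
have n0 := sqnorm_hcoord_gt0 y; have n0' := sqnorm_hcoord_gt0 y'.
have p0 := lt_le_trans (mulr_gt0 k0 n0) ey.
have p0' := lt_le_trans (mulr_gt0 k0 n0') ey'.
rewrite -mulrA ler_wpM2l ?sqmod_ge0// -invfM.
rewrite lef_pV2 ?posrE ?mulr_gt0 ?exprn_gt0//.
apply: le_trans (ler_pM _ _ ey ey'); try by rewrite mulr_ge0 ?ltW.
by rewrite le_eqVlt; apply/orP; left; apply/eqP; ring.
Qed.

Lemma domain_equicontinuous G y (e : R) : (forall u, G u -> G (psl2_inv u)) ->
  domain_of_discontinuity G y -> 0 < e ->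
  exists N, [/\ open N, connected N, N y, N `<=` domain_of_discontinuity G &
    forall u y1 y2, G u -> N y1 -> N y2 ->
      chord (psl2_act u y1) (psl2_act u y2) < e].
Proof.
move=> GV Gy e0; have [k k0 yk] := near_uniformly_expanded GV Gy.
have d0 : 0 < k ^+ 2 * e / 4 by rewrite divr_gt0 ?mulr_gt0 ?exprn_gt0.
have GO : nbhs y (domain_of_discontinuity G).
  exact: open_nbhs_nbhs (conj (open_domain_of_discontinuity GV) Gy).
have [N [oN cN Ny NU]] := CP1_locally_connected
  (filterI GO (filterI yk (nbhs_chord_ball y d0))).
exists N; split=> //; first by move=> z /NU[].
move=> u y1 y2 Gu /NU[_ [e1 c1]] /NU[_ [e2 c2]].
apply: le_lt_trans (uniformly_expanded_chord k0 Gu e1 e2) _.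
rewrite ltr_pdivrMr ?exprn_gt0//.
have := chord_triangle y1 y y2; rewrite chordC in c1.
rewrite /= in c1 c2; lra.
Qed.

End Domain.

(** * Developing maps *)

Section Developing.
Context {R : realType} {S St : topologicalType} (p : St -> S) (x0 : St).
Variable act : pi1 R (p x0) -> St -> St.
Hypotheses (hp : universal_covering R p) (hact : deck_action act).

Let cov : covering_map_between [set: St] [set: S] p := hp.2.

Lemma deck_continuous alpha : continuous (act alpha).
Proof.
have [[_ + _] _] := hact.1 alpha.
rewrite continuous_open_subspace; last exact: openT.
by move=> h x; apply: h; rewrite inE.
Qed.

Lemma deck_injective alpha : injective (act alpha).
Proof.
by have [[[_ inj _] _ _] _] := hact.1 alpha => x y; apply: inj; rewrite inE.
Qed.

(** On the fibre of x0 this is the definition of the action; the other fibres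
    are reached along a path from x0. *)
Lemma deck_transitive x x' : p x' = p x -> exists alpha, act alpha x = x'.
Proof.
have cp := local_homeo_continuous (covering_local_homeo cov).
have base y : p y = p x0 -> exists alpha, act alpha x0 = y.
  move=> py; have [c] := hp.1.1 x0 y.
  have pc : continuous (p \o c).
    by move=> t; apply: continuous_comp; [exact: cts_fun|exact: cp].
  have pc0 : (p \o c) zero = p x0 by rewrite /= path_zero.
  have pc1 : (p \o c) one = p x0 by rewrite /= path_one.
  exists (pi1_class (mk_path pc pc0 pc1)).
  by apply: (hact.2 _ y c).
have [c] := hp.1.1 x0 x => px.
have cc : continuous (fun t : R => c (clamp t)).
  move=> t; apply: continuous_comp; first exact: clamp_continuous.
  exact: cts_fun.
have hD tau : range act tau -> continuous tau /\ p \o tau =1 p.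
  by move=> [alpha _ <-]; split; [exact: deck_continuous|case: (hact.1 alpha)].
have := fibre_transitive cov hD cc; rewrite /=.
have -> : clamp 0 = zero :> I01 R by [].
rewrite path_zero => /(_ _ 1).
have -> : clamp 1 = one :> I01 R by [].
rewrite path_one => h; have [|_ [alpha _ <-] ax] := h _ x' px.
  by move=> y /base[alpha <-]; exists (act alpha) => //; exists alpha.
by exists alpha.
Qed.

(** A Lebesgue number argument on S. Near p x, the inverse branch of f at x
    serves all points of the cover after a deck transformation, and the
    triangle inequality leaves room e / 4 when the branch is defined on the
    disk of size e around f x. *)
Lemma uniform_chart (f : St -> CP1 R) : compact [set: S] -> local_homeo f ->
  exists2 d : R, 0 < d & forall x, exists alpha O,
    [/\ open O, O (act alpha x), set_inj O f &
        forall y, chord (f (act alpha x)) y < d -> (f @` O) y].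
Proof.
move=> kS lf; have cf := local_homeo_continuous lf.
pose P (d : R) s := forall x, p x = s -> exists alpha O,
    [/\ open O, O (act alpha x), set_inj O f &
        forall y, chord (f (act alpha x)) y < d -> (f @` O) y].
have : \forall d \near (0 : R)^'+, [set: S] `<=` P d.
  move/compact_near_coveringP : kS; apply=> s _.
  have [x _ <-] : range p s by case: cov => ->.
  have [W [[oW Wx] ofW [[_ injW _] _ _]]] := lf x.
  have [e e0 eW] : exists2 e : R, 0 < e &
      forall y, chord (f x) y < e -> (f @` W) y.
    by apply: chord_ball_nbhs; apply: open_nbhs_nbhs; split=> //; exists x.
  have e4 : 0 < e / 4 by rewrite divr_gt0.
  pose B : set (CP1 R) := [set y | chord (f x) y < e / 4].
  have oV : open (W `&` f @^-1` B°).
    by apply: openI => //; apply: open_comp => //; exact: open_interior.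
  exists (p @` (W `&` f @^-1` B°), [set d | d < e / 4]) => /=.
    split; last exact: nbhs_right_lt.
    apply: open_nbhs_nbhs; split.
      exact: (local_homeo_open (covering_local_homeo cov)).
    by exists x => //; split=> //; exact: nbhs_chord_ball.
  move=> [_ d] [/= [x1 [Wx1 /interior_subset Bx1] <-] de] x2 px2.
  have [alpha ax2] := deck_transitive (esym px2).
  exists alpha, W; rewrite ax2; split=> // y x1y; apply: eW.
  have := chord_triangle (f x) (f x1) y; move: Bx1; rewrite /B /=.
  move: de x1y; lra.
move=> Pd; have [d [d0 hd]] := filter_ex (filterI (nbhs_right_gt (0 : R)) Pd).
by exists d => // x; exact: (hd (p x) I x).
Qed.

Lemma range_rho_inv (rho : {multiplicative pi1 R (p x0) -> PSL2 R}) u :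
  range rho u -> range rho (psl2_inv u).
Proof.
move=> [a _ <-]; exists (a^-1)%g => //.
have r1 : rho 1%g = 1%g.
  by apply: (mulgI (rho 1%g)); rewrite -gmulfM !mulg1.
apply: (mulgI (rho a)); rewrite -gmulfM mulgV r1.
by rewrite -[RHS]/(rho a * (rho a)^-1)%g mulgV.
Qed.

End Developing.

Theorem theorem3 (R : realType) (g : nat) (S St : topologicalType)
    (p : St -> S) (x0 : St) (act : pi1 R (p x0) -> St -> St)
    (f : St -> CP1 R) (rho : {multiplicative pi1 R (p x0) -> PSL2 R})
    (hg : (2 <= g)%N) (hS : closed_orientable_surface R g S)
    (hp : universal_covering R p) (hact : deck_action act)
    (hdev : developing_pair act f rho) :
  let Omega := domain_of_discontinuity (range rho) in
  forall U : set St,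
    (exists2 x, (f @^-1` Omega) x & U = connected_component (f @^-1` Omega) x) ->
    covering_map_between U (f @` U) f.
Proof.
move=> Omega U [x Ox ->]; have [[hausS kS _ _] _] := hS.
have [lf equiv] := hdev; have cf := local_homeo_continuous lf.
apply: (@covering_of_sheets _ _ f Omega) => //.
  exact: (covering_hausdorff hp.2 hausS).
have [d d0 chart] := uniform_chart hp hact kS lf.
move=> y Oy.
have [N [oN cN Ny NO small]] :=
  domain_equicontinuous (@range_rho_inv _ _ _ _ _ rho) Oy d0.
exists N; split=> // z Nz; have [alpha [W [oW Wz injW dW]]] := chart z.
exists (act alpha @^-1` W `&` f @^-1` N) => //; split.
  apply: openI; last by apply: open_comp.
  by apply: open_comp => // t _; exact: (deck_continuous hact).
split=> [z' []//|z1 z2 /set_mem[Wz1 _] /set_mem[Wz2 _] f12|w Nw].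
  apply: (deck_injective hact (alpha := alpha)).
  by apply: injW; rewrite ?inE// !equiv f12.
have [|w' Ww' w'w] := dW (psl2_act (rho alpha) w).
  by rewrite equiv; apply: small => //; exists alpha.
have [z' az'] : range (act alpha) w'.
  by have [[[_ _ surj] _ _] _] := hact.1 alpha; exact: surj.
move=> az; have fz' : f z' = w.
  apply: (mobius_inj (det_psl2_mx (rho alpha))).
  by have := equiv alpha z'; rewrite az w'w; exact: esym.
by exists z' => //; split; rewrite /= ?az ?fz'.
Qed.
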